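(* Let $X$ be a real polyhedral Banach space such that $X^*$ does not have the approximation property. Then $X$ admits an equivalent norm failing property A$^k$ (that is, $X$ endowed with this equivalent norm does not have property A$^k$).
   Context: A real Banach space is polyhedral if the unit balls of all of its finite-dimensional subspaces are polyhedra, i.e. convex hulls of finitely many points. For Banach spaces $X,Z$, $K(X,Z)$ is the space of compact linear operators from $X$ into $Z$ with the operator norm, and $NA(X,Z)$ is the set of bounded linear operators $T:X\to Z$ attaining their norm, i.e. such that $\|T\|=\|Tx\|$ for some $x\in X$ with $\|x\|=1$. A Banach space $X$ has property A$^k$ if $K(X,Z)\cap NA(X,Z)$ is dense in $K(X,Z)$ for every Banach space $Z$. A Banach space $E$ has the approximation property if for every compact set $C\subset E$ and every $\varepsilon>0$ there is a finite-rank bounded linear operator $R:E\to E$ with $\|x-R(x)\|<\varepsilon$ for all $x\in C$. *)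

(* Defs.v *)
From HB Require Import structures.
From mathcomp Require Import all_boot all_order all_algebra.
From mathcomp Require Import all_classical all_reals.
From mathcomp Require Import convex topology normedtype.

Set Implicit Arguments.
Unset Strict Implicit.
Unset Printing Implicit Defensive.

Import Order.TTheory GRing.Theory Num.Theory.
Import numFieldNormedType.Exports.

Local Open Scope classical_set_scope.
Local Open Scope ring_scope.

Definition unit_ball (R : realType) (X : normedModType R) : set X :=
  [set x | `|x| <= 1].
Arguments unit_ball {R} X _ /.

(* For linear maps boundedness is continuity (linear_bounded_continuous). *)
Definition bounded_linear (R : realType) (X Z : normedModType R) :
    {pred X -> Z} :=
  mem [set f : X -> Z | linear f /\ continuous f].
Arguments bounded_linear {R} X Z _ : rename.

Record boundedOp (R : realType) (X Z : normedModType R) : Type := BoundedOp {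
  boundedOp_fun :> X -> Z;
  _ : boundedOp_fun \in bounded_linear X Z }.

Section BoundedOpLmodule.
Context {R : realType} {X Z : normedModType R}.

HB.instance Definition _ := [isSub for @boundedOp_fun R X Z].
HB.instance Definition _ := [Choice of boundedOp X Z by <:].

Lemma bounded_linear_submod_closed : submod_closed (bounded_linear X Z).
Proof.
split=> [|a f g /set_mem[lf cf] /set_mem[lg cg]]; apply/mem_set; split=> /=.
- by move=> a x y; rewrite -[LHS]/(0 : Z) -[RHS]/(a *: (0 : Z) + 0) scaler0 addr0.
- exact: cst_continuous.
- move=> b x y; rewrite -[LHS]/(a *: f (b *: x + y) + g (b *: x + y)).
  rewrite -[RHS]/(b *: (a *: f x + g x) + (a *: f y + g y)) lf lg.
  by rewrite !scalerDr !scalerA [b * a]mulrC addrACA.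
- by move=> x; apply: cvgD; [apply: cvgZr; exact: cf|exact: cg].
Qed.

HB.instance Definition _ := GRing.isSubmodClosed.Build _ _
  (bounded_linear X Z) bounded_linear_submod_closed.
HB.instance Definition _ := [SubChoice_isSubLmodule of boundedOp X Z by <:].

Lemma boundedOp_linear (T : boundedOp X Z) : linear T.
Proof. by have /set_mem[] := valP T. Qed.

Lemma boundedOp_continuous (T : boundedOp X Z) : continuous T.
Proof. by have /set_mem[] := valP T. Qed.

HB.instance Definition _ (T : boundedOp X Z) :=
  GRing.isLinear.Build R X Z _ T (@boundedOp_linear T).

Definition opnorm (T : boundedOp X Z) : R :=
  sup [set `|T x| | x in unit_ball X].

Lemma opnorm_has_sup (T : boundedOp X Z) :
  has_sup [set `|T x| | x in unit_ball X].
Proof.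
split; first by exists `|T 0|; exists 0 => //; rewrite /unit_ball/= normr0.
have /linear_boundedP/pinfty_ex_gt0[M M0 TM] : bounded_near T (nbhs 0).
  by apply/linear_bounded_continuous; exact: boundedOp_continuous.
exists M => _ [x x1 <-]; apply: (le_trans (TM x)).
by rewrite ler_piMr// ltW.
Qed.

Lemma opnorm_ge (T : boundedOp X Z) x : `|x| <= 1 -> `|T x| <= opnorm T.
Proof. by move=> x1; apply: (ub_le_sup (opnorm_has_sup T).2); exists x. Qed.

Lemma opnorm_le (T : boundedOp X Z) M :
  (forall x, `|x| <= 1 -> `|T x| <= M) -> opnorm T <= M.
Proof.
by move=> TM; apply: ge_sup; [exact: (opnorm_has_sup T).1|move=> _ [x /TM + <-]].
Qed.

Lemma opnorm_ge0 (T : boundedOp X Z) : 0 <= opnorm T.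
Proof. by apply: le_trans (opnorm_ge T (x := 0) _); rewrite ?normr0. Qed.

Lemma opnormP (T : boundedOp X Z) x : `|T x| <= opnorm T * `|x|.
Proof.
have [->|x0] := eqVneq x 0; first by rewrite linear0 !normr0 mulr0.
have nx0 : 0 < `|x| by rewrite normr_gt0.
have := opnorm_ge T (x := `|x|^-1 *: x).
rewrite linearZ !normrZ normfV normr_id mulVf ?gt_eqF// => /(_ (lexx _)).
by rewrite mulrC ler_pdivrMr.
Qed.

Lemma opnormD (S T : boundedOp X Z) : opnorm (S + T) <= opnorm S + opnorm T.
Proof.
apply: opnorm_le => x x1; apply: (le_trans (ler_normD (S x) (T x))).
by rewrite lerD// opnorm_ge.
Qed.

Lemma opnormZ (a : R) (T : boundedOp X Z) : opnorm (a *: T) = `|a| * opnorm T.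
Proof.
have le b (S : boundedOp X Z) : opnorm (b *: S) <= `|b| * opnorm S.
  apply: opnorm_le => x x1; rewrite [leLHS](normrZ b (S x)).
  by rewrite ler_wpM2l// opnorm_ge.
apply/eqP; rewrite eq_le le/=.
have [->|a0] := eqVneq a 0; first by rewrite normr0 mul0r opnorm_ge0.
have := le a^-1 (a *: T); rewrite scalerA mulVf// scale1r normfV.
by rewrite ler_pdivlMl ?normr_gt0.
Qed.

Lemma opnorm_eq0 (T : boundedOp X Z) : opnorm T = 0 -> T = 0.
Proof.
move=> T0; apply/val_inj/funext => x; apply/eqP; rewrite -normr_le0.
by have := opnormP T x; rewrite T0 mul0r.
Qed.

HB.instance Definition _ := Lmodule_isNormed.Build R (boundedOp X Z)
  opnormD opnormZ opnorm_eq0.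

End BoundedOpLmodule.

Section BoundedOpComplete.
Context {R : realType} {X : normedModType R} {Z : completeNormedModType R}.

Lemma boundedOp_distP (S T : boundedOp X Z) x :
  `|S x - T x| <= `|S - T| * `|x|.
Proof. exact: (opnormP (S - T)). Qed.

Lemma boundedOp_complete (F : set_system (boundedOp X Z)) :
  ProperFilter F -> cauchy F -> cvg F.
Proof.
move=> FF Fc; have Fex : cauchy_ex F by apply/cauchyP.
have Fx x : cvg ((fun T : boundedOp X Z => T x) @ F).
  apply: cauchy_cvg; apply: cauchy_exP => e e0.
  have d0 : 0 < e / (`|x| + 1) by rewrite divr_gt0// ltr_wpDl.
  have [T FT] := Fex _ d0; exists (T x).
  change (F [set S | ball (T x) e (S x)]); apply: filterS FT => S.
  rewrite -!ball_normE/= => TS; apply: (le_lt_trans (boundedOp_distP T S x)).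
  have [->|x0] := eqVneq x 0; first by rewrite normr0 mulr0.
  rewrite (@lt_trans _ _ (e / (`|x| + 1) * `|x|)) ?ltr_pM2r ?normr_gt0//.
  by rewrite mulrAC ltr_pdivrMr ?ltr_wpDl// ltr_pM2l// ltrDl.
pose g x := lim ((fun T : boundedOp X Z => T x) @ F).
have gl : linear g.
  move=> a x y; apply: cvg_lim => //.
  rewrite (_ : (fun T : boundedOp X Z => _) =
    (fun T : boundedOp X Z => a *: T x + T y)).
    by apply: cvgD; [apply: cvgZr; exact: Fx|exact: Fx].
  by apply/funext => T; rewrite linearP.
have gT e T x : F (ball T e) -> `|g x - T x| <= e * `|x|.
  move=> FT; have cg : (fun S : boundedOp X Z => `|S x - T x|) @ F -->
      `|g x - T x|.
    by apply: cvg_norm; apply: cvgB; [exact: Fx|exact: cvg_cst].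
  apply: (closed_cvg (fun r => r <= e * `|x|)) cg; first exact: closed_le.
  change (F [set S | `|S x - T x| <= e * `|x|]).
  apply: filterS FT => S; rewrite -ball_normE/= => TS.
  apply: (le_trans (boundedOp_distP S T x)).
  by rewrite ler_wpM2r// distrC ltW.
pose gL : {linear X -> Z} := HB.pack g (GRing.isLinear.Build R X Z _ g gl).
have gc : continuous g.
  apply: (@bounded_linear_continuous _ _ _ gL); apply/linear_boundedP.
  have [T FT] := Fex _ ltr01.
  near=> r => x; rewrite -[gL x](subrK (T x)) (le_trans (ler_normD _ _))//.
  rewrite (@le_trans _ _ ((1 + opnorm T) * `|x|))//.
    by rewrite mulrDl lerD ?opnormP//; exact: gT.
  by rewrite ler_wpM2r//; near: r; apply: nbhs_pinfty_ge; rewrite num_real.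
have gm : g \in bounded_linear X Z by apply/mem_set.
apply/cvg_ex; exists (BoundedOp gm); apply/cvgrPdist_le => e e0.
have e20 : 0 < e / 2 by rewrite divr_gt0.
have [T FT] := Fex _ e20; near=> S.
rewrite -[_ - S](subrKA T) (le_trans (ler_normD _ _))// (splitr e) lerD//.
  apply: opnorm_le => x x1; rewrite (le_trans (gT _ _ x FT))//.
  by rewrite ler_piMr// ltW.
have : ball T (e / 2) S by near: S.
by rewrite -ball_normE/= => /ltW.
Unshelve. all: by end_near. Qed.

HB.instance Definition _ := Uniform_isComplete.Build (boundedOp X Z)
  boundedOp_complete.

End BoundedOpComplete.

(* Definiteness, hence being a norm, follows from equiv_norm_equiv. *)
Record equiv_norm (R : realType) (X : normedModType R) : Type := EquivNorm {
  equiv_norm_fun :> X -> R;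
  equiv_normD : forall x y,
    equiv_norm_fun (x + y) <= equiv_norm_fun x + equiv_norm_fun y;
  equiv_normZ : forall (a : R) x,
    equiv_norm_fun (a *: x) = `|a| * equiv_norm_fun x;
  equiv_norm_equiv : exists m M : R, [/\ 0 < m, 0 < M &
    forall x, m * `|x| <= equiv_norm_fun x <= M * `|x|] }.

(* The vector space X with the norm N in place of its own. *)
Definition renormed (R : realType) (X : normedModType R)
  (N : equiv_norm X) : Type := X.

Section RenormedNormed.
Context {R : realType} {X : normedModType R} (N : equiv_norm X).

HB.instance Definition _ := GRing.Lmodule.copy (renormed N) X.

Lemma equiv_norm_eq0 x : N x = 0 -> x = 0.
Proof.
have [m [M [m0 M0 mM]]] := equiv_norm_equiv N => Nx.
have /andP[+ _] := mM x; rewrite Nx pmulr_rle0// normr_le0.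
by move/eqP.
Qed.

HB.instance Definition _ := Lmodule_isNormed.Build R (renormed N)
  (equiv_normD N) (equiv_normZ N) equiv_norm_eq0.

End RenormedNormed.

Section RenormedComplete.
Context {R : realType} {X : completeNormedModType R} (N : equiv_norm X).

Lemma renormed_complete (F : set_system (renormed N)) :
  ProperFilter F -> cauchy F -> cvg F.
Proof.
move=> FF Fc; have Fex : cauchy_ex F by apply/cauchyP.
have [m [M [m0 M0 mM]]] := equiv_norm_equiv N.
have cF : cauchy (F : set_system X).
  apply: cauchy_exP => e e0.
  have [x Fx] := Fex _ (mulr_gt0 m0 e0); exists (x : X).
  apply: filterS Fx => y; rewrite -!ball_normE/= => xy.
  have /andP[+ _] := mM (x - y : X) => /le_lt_trans /(_ xy).
  by rewrite ltr_pM2l.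
have /cvg_ex[l Fl] : cvg (F : set_system X) by exact: cauchy_cvg cF.
apply/cvg_ex; exists (l : renormed N); apply/cvgrPdist_lt => e e0.
have /cvgrPdist_lt /(_ (e / M)) := Fl; rewrite divr_gt0// => /(_ isT).
apply: filterS => y ly.
have /andP[_ /le_lt_trans] := mM (l - y : X); apply.
by rewrite mulrC -ltr_pdivlMr.
Qed.

HB.instance Definition _ := Uniform_isComplete.Build (renormed N)
  renormed_complete.

End RenormedComplete.

Definition dual_space (R : realType) (X : normedModType R) :
  completeNormedModType R := boundedOp X R^o.

(* The finite-dimensional subspaces are the spans of finite families. *)
Definition finite_dim_subspace (R : realType) (X : normedModType R)
    (F : set X) : Prop :=
  exists (n : nat) (e : 'I_n -> X),
    F = [set \sum_(i < n) c i *: e i | c in [set: 'I_n -> R]].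

Definition convex_hull (R : realType) (X : normedModType R) (A : set X) :
    set X :=
  smallest (@convex_set R X) A.

Definition polyhedral (R : realType) (X : normedModType R) : Prop :=
  forall F : set X, finite_dim_subspace F ->
    exists2 A : set X, finite_set A & F `&` unit_ball X = convex_hull A.

Definition finite_rank (R : realType) (X Z : normedModType R)
    (T : boundedOp X Z) : Prop :=
  finite_dim_subspace (range T).

Definition approximation_property (R : realType)
    (E : completeNormedModType R) : Prop :=
  forall (C : set E) (eps : R), compact C -> 0 < eps ->
    exists2 T : boundedOp E E, finite_rank T &
      forall x, C x -> `|x - T x| < eps.

Definition compact_operators (R : realType) (X Z : normedModType R) :
    set (boundedOp X Z) :=
  [set T : boundedOp X Z | precompact (T @` unit_ball X)].
Arguments compact_operators {R} X Z _ /.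

Definition norm_attaining (R : realType) (X Z : normedModType R) :
    set (boundedOp X Z) :=
  [set T : boundedOp X Z | exists2 x : X, `|x| = 1 & `|T| = `|T x|].
Arguments norm_attaining {R} X Z _ /.

(* K(X, Z) is a subset of the normed space boundedOp X Z, so density of
   K(X, Z) `&` NA(X, Z) in it is inclusion in a norm closure. *)
Definition property_Ak (R : realType) (X : completeNormedModType R) : Prop :=
  forall Z : completeNormedModType R,
    compact_operators X Z `<=`
    closure (compact_operators X Z `&` norm_attaining X Z).

(* Main.v *)
(* The norm of a separable polyhedral space is attained on countably many
   functionals [F n]: Mazur's theorem and Baire's theorem produce smooth points
   on a segment issued from any given point, and by Baire's theorem again the
   tangent functional at a smooth point touches the norm on a set with interior
   points. Weighting the [F n] by a strictly decreasing sequence gives an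
   equivalent norm [q] that locally depends on finitely many of them, whence an
   operator attaining its [q]-norm into a rotund space has finite rank.

   If the dual of [X] fails the approximation property, it fails it on a
   totally bounded sequence [c], and [x |-> (c n x)_n] is a compact operator [T]
   into a space [Z] of bounded sequences, which can be renormed to be rotund. A
   compactness argument in the bidual provides a separable subspace [A] of [X]
   on which [T] is not a limit of finite rank operators. The norm of [X] whose
   unit ball is the closed convex hull of the [q]-ball of [A] and of a small
   ball of [X] then works: an operator close to [T] is much smaller on the small
   ball, hence can attain its norm only at a point of [A], and then its
   restriction to [A] has finite rank. *)
From HB Require Import structures.
Require Import Defs.
From mathcomp Require Import all_boot all_order all_algebra.
From mathcomp Require Import all_classical all_reals.
From mathcomp Require Import interval_inference convex topology normedtype.
From mathcomp Require Import sequences.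
From mathcomp Require Import ring lra.

Set Implicit Arguments.
Unset Strict Implicit.
Unset Printing Implicit Defensive.

Import Order.TTheory GRing.Theory Num.Theory.
Import numFieldNormedType.Exports.

Local Open Scope classical_set_scope.
Local Open Scope ring_scope.

(** * Tangent functionals at smooth points *)

(** The form in which polyhedrality enters the renorming: it concerns single rays, so it passes to
    subspaces at once. *)
Definition ray_affine (R : realType) (Y : normedModType R) : Prop :=
  forall x y : Y, exists a d : R, 0 < d /\
    forall t : R, 0 <= t <= d -> `|x + t *: y| = `|x| + t * a.

Definition dense_seq (R : realType) (Y : normedModType R) (e : nat -> Y) :=
  forall x (d : R), 0 < d -> exists n, `|x - e n| < d.

Lemma ltr_invS_ex (R : realType) (s : R) : 0 < s ->
  exists k : nat, k.+1%:R^-1 < s.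
Proof.
move=> s0; exists (Num.truncn s^-1).
by rewrite -ltf_pV2 ?posrE ?invr_gt0// invrK truncnS_gt.
Qed.

(** The dual unit ball, as bare functions; oddness turns the one-sided bound into a bound on
    [|f x|]. *)
Definition norm_le_linear (R : realType) (Y : normedModType R) (f : Y -> R) :=
  (forall a x y, f (a *: x + y) = a * f x + f y) /\ (forall x, f x <= `|x|).

Section NormLeLinear.
Context {R : realType} {Y : normedModType R} (f : Y -> R).
Hypothesis fl : norm_le_linear f.

Lemma norm_le_linear0 : f 0 = 0.
Proof. by have := fl.1 1 0 0; rewrite scaler0 addr0 mul1r; lra. Qed.

Lemma norm_le_linearZ a x : f (a *: x) = a * f x.
Proof. by have := fl.1 a x 0; rewrite !addr0 norm_le_linear0 addr0. Qed.

Lemma norm_le_linearD x y : f (x + y) = f x + f y.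
Proof. by have := fl.1 1 x y; rewrite scale1r mul1r. Qed.

Lemma norm_le_linearN x : f (- x) = - f x.
Proof. by rewrite -scaleN1r norm_le_linearZ mulN1r. Qed.

Lemma norm_le_linearB x y : f (x - y) = f x - f y.
Proof. by rewrite norm_le_linearD norm_le_linearN. Qed.

Lemma norm_le_linear_abs x : `|f x| <= `|x|.
Proof.
rewrite ler_norml fl.2 andbT lerNl -norm_le_linearN.
by rewrite (le_trans (fl.2 _)) ?normrN.
Qed.

End NormLeLinear.

Section Tangent.
Context {R : realType} {Y : normedModType R} (e : nat -> Y).
Hypothesis eD : dense_seq e.
Hypothesis aff : ray_affine Y.

(** By convexity the second difference divided by [t] is nondecreasing in [t], so one good [t] is
    enough: membership for all [k] means that the norm is Gateaux differentiable at [x] along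
    [e n]. *)
Definition small_bend (n k : nat) : set Y :=
  [set x | exists2 t : R, 0 < t &
    `|x + t *: e n| + `|x - t *: e n| - 2 * `|x| < t / k.+1%:R].

(** The right derivative [D] of the norm at [x] is sublinear. Small bends make it odd on the dense
    sequence, hence everywhere, and an odd sublinear function is linear. *)
Lemma norm_le_linear_tangent (x : Y) : (forall n k, small_bend n k x) ->
  exists2 f, norm_le_linear f & forall z, exists2 d : R, 0 < d &
    forall t : R, 0 <= t <= d -> `|x + t *: z| = f (x + t *: z).
Proof.
move=> xS.
have [D DP] : exists D : Y -> R, forall z, exists2 d : R, 0 < d &
    forall t : R, 0 <= t <= d -> `|x + t *: z| = `|x| + t * D z.
  have /choice[D DP] : forall z, exists a, exists2 d : R, 0 < d &
    forall t : R, 0 <= t <= d -> `|x + t *: z| = `|x| + t * a.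
    by move=> z; have [a [d [d0 H]]] := aff x z; exists a, d.
  by exists D.
(* Convexity: the slope of the norm over a longer segment is at least its initial slope [D z]. *)
have Dle z (t : R) : 0 <= t -> `|x| + t * D z <= `|x + t *: z|.
  move=> t0; have [d d0 H] := DP z.
  have [td|dt] := leP t d; first by rewrite H// t0.
  have t1 : 0 < t by exact: lt_trans dt.
  have : `|x + d *: z| <= (1 - d / t) * `|x| + d / t * `|x + t *: z|.
    have -> : x + d *: z = (1 - d / t) *: x + (d / t) *: (x + t *: z).
      rewrite scalerDr addrA -scalerDl subrK scale1r scalerA divfK//.
      by rewrite gt_eqF.
    have dt0 : 0 <= d / t by rewrite divr_ge0// ltW.
    have dt1 : 0 <= 1 - d / t by rewrite subr_ge0 ler_pdivrMr// mul1r ltW.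
    apply: (le_trans (ler_normD _ _)).
    by rewrite normrZ normrZ (ger0_norm dt0) (ger0_norm dt1).
  rewrite H ?lexx ?(ltW d0)// => Hd.
  have : d * D z <= d / t * (`|x + t *: z| - `|x|) by lra.
  rewrite -mulrA ler_pM2l// mulrC ler_pdivlMr// => ?; lra.
have DD y z : D (y + z) <= D y + D z.
  have [d1 d10 H1] := DP y; have [d2 d20 H2] := DP z.
  pose t := Num.min d1 d2 / 2.
  have t0 : 0 < t by rewrite divr_gt0// lt_min d10.
  have td1 : 0 <= 2 * t <= d1.
    rewrite mulr_ge0// ?(ltW t0)//= /t mulrC divfK ?pnatr_eq0//.
    by rewrite ge_min lexx.
  have td2 : 0 <= 2 * t <= d2.
    rewrite mulr_ge0// ?(ltW t0)//= /t mulrC divfK ?pnatr_eq0//.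
    by rewrite ge_min lexx orbT.
  have := Dle (y + z) _ (ltW t0).
  have -> : x + t *: (y + z) =
      2^-1 *: (x + (2 * t) *: y) + 2^-1 *: (x + (2 * t) *: z).
    rewrite -scalerDr addrACA -[_ + (2 * t) *: z]scalerDr [RHS]scalerDr.
    rewrite scalerA mulrA.
    rewrite mulVf ?pnatr_eq0// mul1r -[x + x]mulr2n -[x *+ 2]scaler_nat scalerA.
    rewrite mulVf ?pnatr_eq0//.
    by rewrite scale1r.
  move=> /le_trans /(_ (ler_normD _ _)).
  rewrite normrZ normrZ (H1 _ td1) (H2 _ td2) gtr0_norm ?invr_gt0// => h.
  have : t * D (y + z) <= t * (D y + D z) by lra.
  by rewrite ler_pM2l.
have DZ a z : 0 < a -> D (a *: z) = a * D z.
  move=> a0; have [d1 d10 H1] := DP z; have [d2 d20 H2] := DP (a *: z).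
  pose t := Num.min (d1 / a) d2.
  have t0 : 0 < t by rewrite lt_min d20 divr_gt0.
  have td1 : 0 <= t * a <= d1.
    by rewrite mulr_ge0 ?(ltW t0) ?(ltW a0)//= -ler_pdivlMr// ge_min lexx.
  have td2 : 0 <= t <= d2 by rewrite (ltW t0)/= ge_min lexx orbT.
  have := H2 _ td2; rewrite scalerA (H1 _ td1) => h.
  have : t * (a * D z) = t * D (a *: z) by lra.
  by move/(mulfI (lt0r_neq0 t0)).
have Dnorm z : D z <= `|z|.
  have [d d0 H] := DP z; have := H d; rewrite lexx (ltW d0) => /(_ isT) h.
  have := ler_normD x (d *: z); rewrite h normrZ gtr0_norm// lerD2l.
  by rewrite ler_pM2l.
have D0 : D 0 = 0.
  by have := DZ 2 0; rewrite scaler0 => /(_ (ltr0n _ _)); lra.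
have De n : D (e n) + D (- e n) <= 0.
  apply/ler_addgt0Pr => s s0; rewrite add0r.
  have [k ks] := ltr_invS_ex s0.
  have [t t0 ht] := xS n k.
  have := Dle (e n) t (ltW t0); have := Dle (- e n) t (ltW t0).
  rewrite scalerN => h1 h2.
  have : t * (D (e n) + D (- e n)) < t / k.+1%:R by apply: le_lt_trans ht; lra.
  rewrite ltr_pM2l// => h; exact: ltW (lt_trans h ks).
(* As [D] is subadditive and below the norm, oddness passes from the [e n] to their limits. *)
have Dodd z : D (- z) = - D z.
  apply/eqP; rewrite eq_le; apply/andP; split; last first.
    by rewrite -subr_ge0 opprK; have := DD (- z) z; rewrite addNr D0.
  rewrite -subr_le0 opprK; apply/ler_addgt0Pr => s s0; rewrite add0r.
  have [|n zn] := eD z (d := s / 2); first by rewrite divr_gt0.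
  have h1 := DD (z - e n) (e n); rewrite subrK in h1.
  have := DD (e n - z) (- e n); rewrite addrAC subrr add0r => h2.
  have := Dnorm (z - e n); have := Dnorm (e n - z); rewrite distrC.
  have := De n; lra.
have Dadd y z : D (y + z) = D y + D z.
  apply/eqP; rewrite eq_le DD/=.
  have := DD (y + z) (- z); rewrite addrK Dodd; lra.
have Dlin a z : D (a *: z) = a * D z.
  have [a0|a0|->] := ltrgt0P a; [exact: DZ| |by rewrite scale0r D0 mul0r].
  rewrite -[a]opprK scaleNr Dodd DZ ?oppr_gt0//; lra.
have Dx : D x = `|x|.
  have [d d0 H] := DP x; have := H d; rewrite lexx (ltW d0) => /(_ isT).
  rewrite -[X in X + _]scale1r -scalerDl normrZ ger0_norm; last by lra.
  move=> h; have : d * `|x| = d * D x by lra.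
  by move/(mulfI (lt0r_neq0 d0)).
exists D; first by split=> // a y z; rewrite Dadd Dlin.
move=> z; have [d d0 H] := DP z; exists d => // t /H ->.
by rewrite Dadd Dlin Dx.
Qed.

End Tangent.

(** * Countable boundaries *)

Section Boundary.
Context {R : realType} {Y : completeNormedModType R} (e : nat -> Y).
Hypothesis eD : dense_seq e.
Hypothesis aff : ray_affine Y.

(** Otherwise the increments of the norm along a grid of step [t] grow by at least [t / k.+1] at
    each node, and after enough nodes they exceed what the Lipschitz bound [t * |e n|] allows. *)
Lemma small_bend_shift n k (x : Y) (r : R) : 0 < r ->
  exists2 s : R, 0 <= s < r & small_bend e n k (x + s *: e n).
Proof.
move=> r0; apply: contrapT => H.
have Hb (s t : R) : 0 <= s < r -> 0 < t -> t / k.+1%:R <=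
    `|x + (s + t) *: e n| + `|x + (s - t) *: e n| - 2 * `|x + s *: e n|.
  move=> sr t0; rewrite leNgt; apply/negP => Hlt; apply: H; exists s => //.
  by exists t => //; move: Hlt; rewrite scalerDl scalerBl !addrA.
pose L := `|e n|.
have [N NL] : exists N : nat, 2 * L * k.+1%:R < N%:R.
  by exists (Num.truncn (2 * L * k.+1%:R)).+1; rewrite truncnS_gt.
(* The nodes [j.+1 * t] with [j <= N] stay strictly below [r]. *)
pose t := r / N.+2%:R.
have t0 : 0 < t by rewrite divr_gt0.
have [u uE] : exists u, u = t / k.+1%:R by exists (t / k.+1%:R).
pose g (j : nat) := `|x + (j%:R * t) *: e n|.
have gS (j : nat) : `|g j.+1 - g j| <= t * L.
  apply: (le_trans (ler_dist_dist _ _)).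
  rewrite opprD addrACA subrr add0r -scalerBl -mulrBl -natr1 addrAC subrr.
  by rewrite add0r mul1r normrZ gtr0_norm.
have bend (j : nat) : (j <= N)%N ->
    g j.+1 - g j + u <= g j.+2 - g j.+1.
  move=> jN; have jr : 0 <= j.+1%:R * t < r.
    rewrite mulr_ge0 ?(ltW t0)//= /t mulrCA gtr_pMr// ltr_pdivrMr//.
    by rewrite mul1r ltr_nat ltnS.
  have := Hb _ _ jr t0.
  have -> : j.+1%:R * t + t = j.+2%:R * t.
    by rewrite -[in RHS]natr1 mulrDl mul1r.
  have -> : j.+1%:R * t - t = j%:R * t by rewrite -natr1 mulrDl mul1r addrK.
  by rewrite /g -uE; lra.
have tele (j : nat) : (j <= N.+1)%N ->
    g 1%N - g 0%N + j%:R * u <= g j.+1 - g j.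
  elim: j => [|j IH] jN; first by rewrite mul0r addr0.
  apply: le_trans (bend j jN); rewrite -natr1 mulrDl mul1r addrA lerD2r.
  exact: IH (ltnW jN).
have := tele N.+1 (leqnn _); have := gS 0%N; have := gS N.+1.
rewrite !ler_norml => /andP[_ h1] /andP[h2 _] h3.
have : N.+1%:R * u <= 2 * t * L by lra.
rewrite uE mulrA ler_pdivrMr// -natr1 => h4.
have : t * (N%:R + 1) <= t * (2 * L * k.+1%:R) by lra.
by rewrite ler_pM2l// => h5; lra.
Qed.

(** The same [t] serves nearby points: passing from [x] to [y] changes the second difference by at
    most [4 * |x - y|]. *)
Lemma small_bend_open n k : open (small_bend e n k).
Proof.
rewrite openE => x [t t0 xt].
pose d := t / k.+1%:R - (`|x + t *: e n| + `|x - t *: e n| - 2 * `|x|).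
have d0 : 0 < d / 4 by rewrite divr_gt0// subr_gt0.
apply/nbhs_ballP; exists (d / 4) => // y; rewrite -ball_normE/= => xy.
exists t => //.
have shift v : `|y + v| <= `|x + v| + `|x - y|.
  rewrite (_ : y + v = (x + v) - (x - y)) ?ler_normB//.
  by rewrite opprB [x + v]addrC addrACA subrr addr0 addrC.
have hp := shift (t *: e n); have hm := shift (- (t *: e n)).
have hy : `|x| <= `|y| + `|x - y|.
  by rewrite -{1}[x](subrK y) addrC ler_normD.
apply: (@le_lt_trans _ _ ((`|x + t *: e n| + `|x - t *: e n| - 2 * `|x|) +
  4 * `|x - y|)); first lra.
rewrite -ltrBrDl -/d mulrC -ltr_pdivlMr//.
Qed.

(** Baire's theorem is applied to the direction [y] rather than to the point, so that smooth points
    converge to [x0] along a single ray. *)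
Lemma small_bend_dense (x0 : Y) : exists y : Y, forall m n k,
  small_bend e n k (x0 + m.+1%:R^-1 *: y).
Proof.
pose O (i : nat * nat * nat) : set Y :=
  [set y | small_bend e i.1.2 i.2 (x0 + i.1.1.+1%:R^-1 *: y)].
(* Integers that code no triple get the whole space, which is open and dense. *)
pose F (j : nat) : set Y := if unpickle j is Some i then O i else setT.
have /Baire/(_ setT) : forall j, open (F j) /\ dense (F j).
  move=> j; rewrite /F; case: unpickle => [[[m n] k]|]; last first.
    by split; [exact: openT|move=> D [y Dy] _; exists y].
  have m0 : (m.+1%:R^-1 : R) != 0 by rewrite invr_eq0 pnatr_eq0.
  split.
    apply: (@open_comp _ _ (fun y => x0 + m.+1%:R^-1 *: y)); last first.
      exact: small_bend_open.
    by move=> y _; apply: cvgD; [exact: cvg_cst|exact: scaler_continuous].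
  move=> D [y Dy]; rewrite openE => /(_ _ Dy)/nbhs_ballP[r/= r0 yr].
  have r1 : 0 < r / (m.+1%:R * (`|e n| + 1)).
    by rewrite divr_gt0// mulr_gt0// ltr_wpDl.
  have [s /andP[s0 sr] sS] := small_bend_shift n k (x0 + m.+1%:R^-1 *: y) r1.
  exists (y + (m.+1%:R * s) *: e n); split; last first.
    rewrite /O/= scalerDr scalerA mulrA mulVf ?pnatr_eq0// mul1r addrA.
    exact: sS.
  apply: yr; rewrite -ball_normE/= opprD addrA subrr add0r normrN normrZ.
  rewrite ger0_norm ?mulr_ge0//.
  move: sr; rewrite ltr_pdivlMr ?mulr_gt0// ?ltr_wpDl// => sr.
  apply: le_lt_trans sr; rewrite [s * _]mulrCA mulrA.
  by rewrite ler_wpM2l ?mulr_ge0// lerDl.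
case; [by exists 0|exact: openT|].
move=> y [_ yF]; exists y => m n k.
by have := yF (pickle (m, n, k)) I; rewrite /F pickleK.
Qed.

Definition contact (f : Y -> R) : set Y := [set u | `|u| <= f u].

Lemma contact_closed (f : Y -> R) : norm_le_linear f -> closed (contact f).
Proof.
move=> fl u uC; apply/ler_addgt0Pr => s s0.
have s20 : 0 < s / 2 by rewrite divr_gt0.
have [v [vC uv]] := uC (ball u (s / 2)) (nbhsx_ballx _ _ s20).
move: uv; rewrite -ball_normE/= => uv.
have := norm_le_linear_abs fl (u - v); rewrite (norm_le_linearB fl) ler_norml.
move=> /andP[h _]; have := ler_normD (u - v) v; rewrite subrK.
by move: vC; rewrite /contact/=; lra.
Qed.

(** If the contact set had empty interior, Baire's theorem would give a direction [z] with
    [x + z / m.+1] outside it for every [m], against the hypothesis for large [m]. *)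
Lemma contact_interior (f : Y -> R) (x : Y) : norm_le_linear f ->
  (forall z, exists2 d : R, 0 < d &
     forall t : R, 0 <= t <= d -> `|x + t *: z| = f (x + t *: z)) ->
  exists a, exists2 r : R, 0 < r & ball a r `<=` contact f.
Proof.
move=> fl xf; apply: contrapT => H.
pose G (m : nat) : set Y := [set z | ~ contact f (x + m.+1%:R^-1 *: z)].
have /Baire/(_ setT) : forall m, open (G m) /\ dense (G m).
  move=> m; have m0 : (m.+1%:R^-1 : R) != 0 by rewrite invr_eq0 pnatr_eq0.
  split.
    apply: (@open_comp _ _ (fun z => x + m.+1%:R^-1 *: z) (~` contact f)).
      by move=> y _; apply: cvgD; [exact: cvg_cst|exact: scaler_continuous].
    by apply: closed_openC; exact: contact_closed.
  move=> D [z Dz]; rewrite openE => /(_ _ Dz)/nbhs_ballP[r/= r0 zr].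
  apply: contrapT => H'; apply: H; exists (x + m.+1%:R^-1 *: z), (r / m.+1%:R).
    by rewrite divr_gt0.
  move=> u; rewrite -ball_normE/= => xu; apply: contrapT => uC; apply: H'.
  exists (m.+1%:R *: (u - x)); split.
    apply: zr; rewrite -ball_normE/=; move: xu.
    rewrite ltr_pdivlMr// => xu.
    rewrite (_ : z - _ = m.+1%:R *: (x + m.+1%:R^-1 *: z - u)); last first.
      have mz : (m.+1%:R : R) != 0 by rewrite pnatr_eq0.
      by rewrite -{1}[z](scalerKV mz) -scalerBr opprB addrA [x + _]addrC.
    by rewrite normrZ ger0_norm// mulrC.
  by rewrite /G/= scalerA mulVf ?pnatr_eq0// scale1r addrC subrK.
case; [by exists 0|exact: openT|].
move=> z [_ zG]; have [d d0 zd] := xf z; have [m md] := ltr_invS_ex d0.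
by apply: (zG m I); rewrite /contact/= zd// invr_ge0 ler0n ltW.
Qed.

(** Both functionals equal the norm on a common ball, and a linear function is determined by its
    values on a ball. *)
Lemma contact_inj (f g : Y -> R) a (r s : R) : norm_le_linear f ->
  norm_le_linear g -> 0 < r -> 0 < s ->
  ball a r `<=` contact f -> ball a s `<=` contact g -> f = g.
Proof.
move=> fl gl r0 s0 fC gC; apply/funext => z.
have e0 : 0 < Num.min r s by rewrite lt_min r0.
pose t := Num.min r s / (`|z| + 1).
have t0 : 0 < t by rewrite divr_gt0// ltr_wpDl.
have ab : ball a (Num.min r s) (a + t *: z).
  rewrite -ball_normE/= opprD addrA subrr add0r normrN normrZ gtr0_norm//.
  by rewrite /t mulrAC ltr_pdivrMr ?ltr_wpDl// ltr_pM2l// ltrDl.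
have aa : ball a (Num.min r s) a by exact: ballxx.
have eq u : ball a (Num.min r s) u -> f u = g u.
  move=> au; have au1 : ball a r u by apply: le_ball au; rewrite ge_min lexx.
  have au2 : ball a s u by apply: le_ball au; rewrite ge_min lexx orbT.
  have := fC _ au1; have := gC _ au2; have := fl.2 u; have := gl.2 u.
  by rewrite /contact/=; lra.
have := eq _ ab; have := eq _ aa.
rewrite (norm_le_linearD fl) (norm_le_linearD gl).
rewrite (norm_le_linearZ fl) (norm_le_linearZ gl) => -> /addrI.
by apply: mulfI; rewrite gt_eqF.
Qed.

(* The set of functionals touching the norm on a set with interior points is
   countable, because such sets have disjoint interiors. *)
Theorem countable_boundary : exists F : nat -> Y -> R,
  (forall n, norm_le_linear (F n)) /\ forall x, exists n, F n x = `|x|.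
Proof.
pose good n (f : Y -> R) := norm_le_linear f /\
  exists2 r : R, 0 < r & ball (e n) r `<=` contact f.
have l0 : norm_le_linear (fun _ : Y => 0 : R).
  by split=> [a x y|x]; rewrite ?mulr0 ?addr0 ?normr_ge0.
(* At most one functional is good at [n]; [F n] is that one, or zero by default. *)
have /choice[F FP] : forall n, exists f,
    norm_le_linear f /\ forall g, good n g -> g = f.
  move=> n; have [[f fg]|H] := pselect (exists f, good n f); last first.
    by exists (fun=> 0); split=> // f fg; case: H; exists f.
  exists f; have [fl [r r0 fr]] := fg; split=> // g [gl [s s0 gs]].
  exact: contact_inj gs fr.
exists F; split=> [n|x0]; first exact: (FP n).1.
have [y yS] := small_bend_dense x0.
have [a [d [d0 ad]]] := aff x0 y.
have [m md] := ltr_invS_ex d0.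
(* The tangent [f] is taken at an interior point of a segment on which the norm is affine. The norm
   minus [f] is affine and nonnegative there and vanishes inside, hence also at [x0]. *)
have [f fl xf] := norm_le_linear_tangent eD aff (yS m).
have fx1 : f (x0 + m.+1%:R^-1 *: y) = `|x0 + m.+1%:R^-1 *: y|.
  have [t t0 /(_ t)] := xf 0; rewrite (ltW t0) lexx => /(_ isT).
  by rewrite scaler0 addr0.
have [b [r r0 br]] := contact_interior fl xf.
have [n bn] := eD b r0.
exists n; have -> : F n = f.
  apply/esym/(FP n).2; split=> //.
  exists (r - `|b - e n|); first by rewrite subr_gt0.
  apply: subset_trans br => u; rewrite -!ball_normE/= => nu.
  rewrite -[b - u](subrKA (e n)) (le_lt_trans (ler_normD _ _))//.
  by rewrite addrC -ltrBrDr.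
have s0 : (0 : R) < m.+1%:R^-1 by rewrite invr_gt0.
move: fx1; rewrite ad ?(ltW md) ?(ltW s0)//.
rewrite (norm_le_linearD fl) (norm_le_linearZ fl).
set s := m.+1%:R^-1 => fx1.
have := fl.2 x0; have := fl.2 (x0 + d *: y).
rewrite ad ?lexx ?(ltW d0)// (norm_le_linearD fl) (norm_le_linearZ fl) => h1 h2.
apply/eqP; rewrite eq_le h2/=.
(* x0 is an endpoint of a segment on which both f and the norm are affine *)
have h3 : s * (`|x0| + d * a) >= s * (f x0 + d * f y) by rewrite ler_pM2l.
have h4 : d * (`|x0| + s * a) = d * (f x0 + s * f y) by rewrite fx1.
have : (d - s) * `|x0| <= (d - s) * f x0 by lra.
by rewrite ler_pM2l// subr_gt0.
Qed.

End Boundary.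

(** * Polyhedral norms are affine along short segments *)

Lemma convex_hull_combination (R : realType) (X : normedModType R) (s : seq X)
    (u : X) : convex_hull [set` s] u ->
  exists l : 'I_(size s) -> R, [/\ forall i, 0 <= l i, \sum_i l i = 1 &
    u = \sum_i l i *: s`_i].
Proof.
pose C : set X := [set u | exists l : 'I_(size s) -> R,
  [/\ forall i, 0 <= l i, \sum_i l i = 1 & u = \sum_i l i *: s`_i]].
apply: (@smallest_sub _ _ _ C).
  move=> x y k /set_mem[l [l0 l1 ->]] /set_mem[m [m0 m1 ->]]; apply/mem_set.
  have k1 : 0 <= 1 - k%:num by rewrite subr_ge0.
  exists (fun i => k%:num * l i + (1 - k%:num) * m i); split.
  - by move=> i; rewrite addr_ge0 ?mulr_ge0.
  - by rewrite big_split/= -!mulr_sumr l1 m1 !mulr1 subrKC.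
  - rewrite /conv/= !scaler_sumr -big_split/=; apply: eq_bigr => i _.
    by rewrite [RHS]scalerDl !scalerA.
move=> a /= sa; have ia : (index a s < size s)%N by rewrite index_mem.
exists (fun i => (i == Ordinal ia)%:R); split=> [//||].
  by rewrite (bigD1 (Ordinal ia))//= eqxx big1 ?addr0// => i /negPf ->.
rewrite (bigD1 (Ordinal ia))//= eqxx scale1r nth_index// big1 ?addr0// => i.
by move=> /negPf ->; rewrite scale0r.
Qed.

Section ConeNorm.
Context {R : realType} {X : normedModType R} {m : nat} (a : 'I_m -> X).
Hypothesis a1 : forall i, `|a i| <= 1.

Lemma combination_norm_le (l : 'I_m -> R) : (forall i, 0 <= l i) ->
  `|\sum_i l i *: a i| <= \sum_i l i.
Proof.
move=> l0; apply: (le_trans (ler_norm_sum _ _ _)); apply: ler_sum => i _.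
by rewrite normrZ ger0_norm// ler_piMr.
Qed.

(* the points of the open cone spanned by the [a i], [mu i > 0], all lie in
   one face *)
Lemma combination_norm_eq (mu nu : 'I_m -> R) :
  (forall i, 0 <= mu i) -> `|\sum_i mu i *: a i| = \sum_i mu i ->
  (forall i, 0 <= nu i) -> (forall i, mu i = 0 -> nu i = 0) ->
  `|\sum_i nu i *: a i| = \sum_i nu i.
Proof.
move=> mu0 muE nu0 mn; apply/eqP; rewrite eq_le combination_norm_le//=.
pose K := \sum_i nu i / mu i.
have K0 : 0 <= K by apply: sumr_ge0 => i _; rewrite divr_ge0.
have Kle i : 0 <= K * mu i - nu i.
  rewrite subr_ge0; have [m0|m0] := eqVneq (mu i) 0.
    by rewrite mn// mulr_ge0.
  rewrite -ler_pdivrMr ?lt_neqAle 1?eq_sym ?m0 ?mu0//.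
  rewrite /K (bigD1 i)//= lerDl; apply: sumr_ge0 => j _.
  by rewrite divr_ge0.
have : `|K *: \sum_i mu i *: a i| <=
    \sum_i (K * mu i - nu i) + `|\sum_i nu i *: a i|.
  rewrite (_ : K *: _ = \sum_i (K * mu i - nu i) *: a i + \sum_i nu i *: a i).
    by rewrite (le_trans (ler_normD _ _))// lerD2r combination_norm_le.
  rewrite -big_split/= scaler_sumr; apply: eq_bigr => i _.
  by rewrite -scalerDl subrK scalerA.
rewrite normrZ ger0_norm// muE sumrB -mulr_sumr; lra.
Qed.

End ConeNorm.

(** Pigeonhole: if each value stopped occurring at some index, no value would be left at the largest
    of these indices. *)
Lemma frequent_value (T : finType) (f : nat -> T) :
  exists v, forall N, exists2 n, (N <= n)%N & f n = v.
Proof.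
apply: contrapT => H.
have /choice[g gP] : forall v, exists N, forall n, (N <= n)%N -> f n <> v.
  move=> v; apply: contrapT => H'; apply: H; exists v => N.
  apply: contrapT => H''; apply: H'; exists N => n Nn fn; apply: H''.
  by exists n.
by apply: (gP (f (\max_v g v)) (\max_v g v)) => //; exact: leq_bigmax.
Qed.

(** In the plane of [x] and [y], each vector is a nonnegative combination of vertices with weights
    summing to its norm. Infinitely many points [x + y / n.+1] use the same vertices, so they lie
    over one face, where the norm is additive; letting [n] grow reaches [x] itself. *)
Lemma polyhedral_ray_affine (R : realType) (X : normedModType R) :
  polyhedral X -> ray_affine X.
Proof.
move=> pX x y.
pose e (i : 'I_2) := if i == ord0 then x else y.
pose F : set X := [set \sum_(i < 2) c i *: e i | c in [set: 'I_2 -> R]].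
have [|A /finite_seqP[s ->] Fs] := pX F; first by exists 2, e.
have s1 (i : 'I_(size s)) : `|s`_i| <= 1.
  suff : (F `&` unit_ball X) s`_i by case.
  by rewrite Fs; apply: sub_gen_smallest => /=; exact: mem_nth.
have Fc (t : R) : F (x + t *: y).
  exists (fun i => if i == ord0 then 1 else t) => //.
  by rewrite big_ord_recl big_ord1/= /e/= scale1r.
have FZ b u : F u -> F (b *: u).
  move=> [c _ <-]; exists (fun i => b * c i) => //; rewrite scaler_sumr.
  by apply: eq_bigr => i _; rewrite scalerA.
have repr u : F u -> exists mu : 'I_(size s) -> R,
    [/\ forall i, 0 <= mu i, \sum_i mu i = `|u| & u = \sum_i mu i *: s`_i].
  move=> Fu; have [->|u0] := eqVneq u 0.
    exists (fun=> 0); split => //; first by rewrite big1// normr0.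
    by rewrite big1// => i _; rewrite scale0r.
  have nu : `|u| != 0 by rewrite normr_eq0.
  have : (F `&` unit_ball X) (`|u|^-1 *: u).
    split; first exact: FZ.
    by rewrite /unit_ball/= normrZ normfV normr_id mulVf.
  rewrite Fs => /convex_hull_combination[l [l0 l1 ul]].
  exists (fun i => `|u| * l i); split.
  - by move=> i; rewrite mulr_ge0.
  - by rewrite -mulr_sumr l1 mulr1.
  - under eq_bigr do rewrite -scalerA.
    by rewrite -scaler_sumr -ul scalerA divff// scale1r.
pose t (n : nat) : R := n.+1%:R^-1.
have t0 n : 0 < t n by rewrite invr_gt0.
have /choice[mu muP] : forall n, exists mu : 'I_(size s) -> R,
    [/\ forall i, 0 <= mu i, \sum_i mu i = `|x + t n *: y| &
      x + t n *: y = \sum_i mu i *: s`_i].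
  by move=> n; exact: repr.
have [I If] := frequent_value (fun n => [set i | mu n i != 0]%SET).
have [n0 _ In0] := If 0%N.
have [d dE] : exists d, d = t n0 by exists (t n0).
have d0 : 0 < d by rewrite dE.
pose g (r : R) := `|x + r *: y|.
have gcv (r u q : R) : 0 <= q <= 1 ->
    g (q * r + (1 - q) * u) <= q * g r + (1 - q) * g u.
  move=> /andP[q0 q1]; rewrite /g.
  rewrite (_ : x + _ = q *: (x + r *: y) + (1 - q) *: (x + u *: y)).
    apply: (le_trans (ler_normD _ _)).
    by rewrite normrZ normrZ ger0_norm// ger0_norm// subr_ge0.
  rewrite !scalerDr addrACA -scalerDl [q + _]addrC subrK scale1r.
  by rewrite !scalerA -scalerDl.
(* The point at [r] lies between those at [t n] and [d]; mixing their weights keeps the support [I],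
   so its norm is the sum of the mixed weights. *)
have gaff n (r : R) : [set i | mu n i != 0]%SET = I -> t n < r <= d ->
    (d - t n) * g r = (r - t n) * g d + (d - r) * g (t n).
  move=> In /andP[nr rd].
  have nd : t n < d by exact: lt_le_trans rd.
  have [h0 h1 h2] := muP n; have [k0 k1 k2] := muP n0.
  pose nu i := (r - t n) * mu n0 i + (d - r) * mu n i.
  have rn0 : 0 <= r - t n by rewrite subr_ge0 ltW.
  have rd0 : 0 <= d - r by rewrite subr_ge0.
  have -> : (d - t n) * g r = `|\sum_i nu i *: s`_i|.
    rewrite (_ : \sum_i _ = (d - t n) *: (x + r *: y)).
      by rewrite normrZ gtr0_norm// subr_gt0.
    under eq_bigr do rewrite scalerDl -!scalerA.
    rewrite big_split/= -!scaler_sumr -h2 -k2 !scalerDr addrACA -scalerDl.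
    by rewrite !scalerA -scalerDl; congr (_ *: _ + _ *: _); rewrite ?dE; ring.
  rewrite (combination_norm_eq s1 (mu := mu n0)) //.
  - by rewrite big_split/= -!mulr_sumr h1 k1 -dE.
  - by rewrite -k2 k1.
  - by move=> i; rewrite addr_ge0// mulr_ge0.
  - move=> i mi; rewrite /nu mi mulr0 add0r.
    have : i \notin [set i | mu n i != 0]%SET by rewrite In -In0 inE mi eqxx.
    by rewrite inE negbK => /eqP ->; rewrite mulr0.
exists ((g d - `|x|) / d), d; split=> // r /andP[r0 rd].
have -> : `|x| + r * ((g d - `|x|) / d) = (r * g d + (d - r) * `|x|) / d.
  by field; rewrite gt_eqF.
apply/eqP; rewrite eq_le ler_pdivlMr// ler_pdivrMr//; apply/andP; split.
  have rd1 : 0 <= r / d <= 1.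
    by rewrite divr_ge0 ?(ltW d0)//= ler_pdivrMr// mul1r.
  have := gcv d 0 _ rd1; rewrite mulr0 addr0 divfK ?gt_eqF// => h.
  have {h} : g r * d <= (r / d * g d + (1 - r / d) * g 0) * d.
    by rewrite ler_pM2r.
  have -> : (r / d * g d + (1 - r / d) * g 0) * d = r * g d + (d - r) * g 0.
    by field; rewrite gt_eqF.
  by rewrite [g 0]/g scale0r addr0.
have [->|rN0] := eqVneq r 0.
  by rewrite mul0r add0r subr0 scale0r addr0 mulrC.
have {r0 rN0}r0 : 0 < r by rewrite lt_neqAle eq_sym rN0.
apply/ler_addgt0Pr => eps eps0.
(* In the limit [t n] to [0], the error in the lower bound is at most [t n * (g d + d * |y|)]; the
   added [1] makes [C] positive. *)
pose C := g d + d * `|y| + 1.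
have C0 : 0 < C by rewrite /C /g ltr_wpDl// addr_ge0// mulr_ge0// ltW.
have e0 : 0 < Num.min r (eps / C) by rewrite lt_min r0 divr_gt0.
have [N Nlt] := ltr_invS_ex e0.
have [n Nn In] := If N.
have : t n < Num.min r (eps / C).
  apply: le_lt_trans Nlt; rewrite /t lef_pV2 ?posrE// ler_nat.
  by rewrite ltnS.
rewrite lt_min => /andP[tr]; rewrite ltr_pdivlMr// => tC.
have := gaff n r In; rewrite tr rd => /(_ isT) E.
have gn : `|x| - t n * `|y| <= g (t n).
  rewrite lerBlDr /g -[X in `|X| <= _](addrK (t n *: y)).
  by rewrite (le_trans (ler_normB _ _))// normrZ gtr0_norm.
have g0 : 0 <= g r by rewrite normr_ge0.
have h1 : (d - t n) * g r <= d * g r.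
  by rewrite ler_wpM2r// gerBl ltW.
have h2 : (d - r) * (`|x| - t n * `|y|) <= (d - r) * g (t n).
  by rewrite ler_wpM2l// subr_ge0.
have h3 : 0 <= r * (t n * `|y|) by rewrite !mulr_ge0// ltW.
have h4 : t n * (g d + d * `|y| + 1) < eps by [].
rewrite -/(g r); have := t0 n; lra.
Qed.

(** * Norms locally depending on finitely many functionals *)

(* Fonf's norm [q]: weighting the functionals of a countable boundary by a
   strictly decreasing sequence makes [q] depend locally on finitely many of
   them. *)
Lemma locally_finite_norm (R : realType) (Y : completeNormedModType R)
    (e : nat -> Y) : dense_seq e -> ray_affine Y ->
  exists (F : nat -> Y -> R) (q : Y -> R), [/\
    forall n, norm_le_linear (F n),
    forall x y, q (x + y) <= q x + q y,
    forall a x, q (a *: x) = `|a| * q x,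
    forall x, `|x| <= q x <= 2 * `|x| &
    forall x, x != 0 -> exists (n : nat) (d : R), 0 < d /\ forall y,
      `|y| <= d -> (forall j, (j < n)%N -> F j y = 0) -> q (x + y) <= q x].
Proof.
move=> eD aff; have [F [Fl Fb]] := countable_boundary eD aff.
(* The weights decrease strictly to [1], so [q x] exceeds [|x|] by a definite amount while late
   functionals contribute little more than [|x|]. *)
have [w wE] : exists w : nat -> R, forall n, w n = 1 + n.+1%:R^-1.
  by exists (fun n => 1 + n.+1%:R^-1).
have w0 n : 0 <= w n by rewrite wE addr_ge0// invr_ge0.
have w1 n : 1 < w n by rewrite wE ltrDl invr_gt0.
have w2 n : w n <= 2.
  by rewrite wE -[leRHS]/(1 + 1) lerD2l invf_le1// ler1n.
pose E x : set R := [set w n * `|F n x| | n in setT].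
pose q x := sup (E x).
have Ele x n : w n * `|F n x| <= 2 * `|x|.
  by rewrite ler_pM// (norm_le_linear_abs (Fl n)).
have Esup x : has_sup (E x).
  split; first by exists (w 0%N * `|F 0%N x|); exists 0%N.
  by exists (2 * `|x|) => _ [n _ <-].
have qge x n : w n * `|F n x| <= q x.
  by apply: (ub_le_sup (Esup x).2); exists n.
have qle x M : (forall n, w n * `|F n x| <= M) -> q x <= M.
  by move=> H; apply: ge_sup; [exact: (Esup x).1|move=> _ [n _ <-]].
have qattain x : exists n, w n * `|x| <= q x.
  by have [n Fn] := Fb x; exists n; rewrite -[`|x|]normr_id -Fn.
have qZ a x : q (a *: x) <= `|a| * q x.
  apply: qle => n; rewrite (norm_le_linearZ (Fl n)) normrM mulrCA.
  by rewrite ler_wpM2l.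
exists F, q; split=> //.
- move=> x y; apply: qle => n; rewrite (norm_le_linearD (Fl n)).
  apply: le_trans (lerD (qge x n) (qge y n)).
  by rewrite -mulrDr ler_wpM2l// ler_normD.
- move=> a x; apply/eqP; rewrite eq_le qZ/=.
  have [->|a0] := eqVneq a 0.
    rewrite normr0 mul0r (le_trans _ (qge _ 0%N))// mulr_ge0//.
  by have := qZ a^-1 (a *: x); rewrite scalerA mulVf// scale1r normfV
    ler_pdivlMl ?normr_gt0.
- move=> x; rewrite qle// andbT; have [n] := qattain x.
  by apply: le_trans; rewrite ler_peMl// ltW.
- move=> x x0; have [m mx] := qattain x.
  have nx : 0 < `|x| by rewrite normr_gt0.
  have gap : 0 < (w m - 1) * `|x| by rewrite mulr_gt0// subr_gt0.
  (* For [n >= n0], [w n - 1] is at most half of [w m - 1]; with the [d] below,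
     [w n * (|x| + d) <= w m * |x| <= q x]. *)
  have [n0 n0w] := ltr_invS_ex (divr_gt0 gap (mulr_gt0 (ltr0n _ 2) nx)).
  pose d := (w m - 1) * `|x| / 4.
  exists n0, d; split; first by rewrite divr_gt0.
  move=> y yd Fy; apply: qle => n; rewrite (norm_le_linearD (Fl n)).
  have [/Fy ->|n0n] := ltnP n n0; first by rewrite addr0.
  have wn : w n <= 1 + n0.+1%:R^-1.
    by rewrite wE lerD2l lef_pV2 ?posrE// ler_nat.
  apply: le_trans mx.
  have h1 : `|F n x + F n y| <= `|x| + d.
    rewrite (le_trans (ler_normD _ _))// lerD ?(norm_le_linear_abs (Fl n))//.
    by rewrite (le_trans (norm_le_linear_abs (Fl n) _)).
  have h2 : (w n - 1) * `|x| <= (w m - 1) * `|x| / 2.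
    move: n0w; rewrite ltr_pdivlMr ?mulr_gt0// => n0w.
    have : (w n - 1) * `|x| <= n0.+1%:R^-1 * `|x|.
      by rewrite ler_pM2r// lerBlDl.
    by move: (n0.+1%:R^-1) n0w => u; lra.
  have h3 : w n * `|F n x + F n y| <= w n * (`|x| + d) by rewrite ler_wpM2l.
  have h4 : w n * d <= 2 * d by rewrite ler_wpM2r// divr_ge0// ltW.
  by rewrite /d in h3 h4; lra.
Qed.

(** * Closed subspaces *)

(** Bundled so that the subspace can carry its own norm and, in a complete space, be a Banach
    space. *)
Record closedSubspace (R : realType) (V : normedModType R) := ClosedSubspace {
  subspace_set :> set V;
  subspace_closed : closed subspace_set;
  subspace0 : subspace_set 0;
  subspaceP : forall a x y, subspace_set x -> subspace_set y ->
    subspace_set (a *: x + y) }.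

Definition subspace_pred (R : realType) (V : normedModType R)
  (A : closedSubspace V) : {pred V} := mem (subspace_set A).

Record subspace_type (R : realType) (V : normedModType R)
    (A : closedSubspace V) := SubspaceElt {
  subspace_val :> V;
  _ : subspace_val \in subspace_pred A }.

Section SubspaceNormed.
Context {R : realType} {V : normedModType R} (A : closedSubspace V).

HB.instance Definition _ := [isSub for @subspace_val R V A].
HB.instance Definition _ := [Choice of subspace_type A by <:].

Lemma subspace_submod_closed : submod_closed (subspace_pred A).
Proof.
split=> [|a x y /set_mem xA /set_mem yA]; apply/mem_set; first exact: subspace0.
exact: subspaceP.
Qed.

HB.instance Definition _ := GRing.isSubmodClosed.Build _ _
  (subspace_pred A) subspace_submod_closed.
HB.instance Definition _ := [SubChoice_isSubLmodule of subspace_type A by <:].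

Lemma subspace_set_val (x : subspace_type A) : subspace_set A (val x).
Proof. exact: set_mem (valP x). Qed.

Definition to_subspace x (xA : subspace_set A x) : subspace_type A :=
  SubspaceElt (mem_set xA : x \in subspace_pred A).

Definition subspace_norm (x : subspace_type A) : R := `|val x|.

Lemma subspace_normD x y :
  subspace_norm (x + y) <= subspace_norm x + subspace_norm y.
Proof. exact: ler_normD. Qed.

Lemma subspace_normZ a x : subspace_norm (a *: x) = `|a| * subspace_norm x.
Proof. exact: normrZ. Qed.

Lemma subspace_norm_eq0 x : subspace_norm x = 0 -> x = 0.
Proof. by move=> /eqP; rewrite normr_eq0 => /eqP x0; exact/val_inj. Qed.

HB.instance Definition _ := Lmodule_isNormed.Build R (subspace_type A)
  subspace_normD subspace_normZ subspace_norm_eq0.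

Lemma subspace_linearE a (x y : subspace_type A) :
  val (a *: x + y) = a *: val x + val y.
Proof. by []. Qed.

Lemma subspace_normE (x : subspace_type A) : `|x| = `|val x|.
Proof. by []. Qed.

End SubspaceNormed.

Section SubspaceComplete.
Context {R : realType} {V : completeNormedModType R} (A : closedSubspace V).

Lemma subspace_complete (F : set_system (subspace_type A)) :
  ProperFilter F -> cauchy F -> cvg F.
Proof.
move=> FF Fc; have Fex : cauchy_ex F by apply/cauchyP.
pose v : subspace_type A -> V := val.
have /cvg_ex[l Fl] : cvg (v @ F).
  apply: cauchy_cvg; apply: cauchy_exP => e e0.
  have [x Fx] := Fex _ e0; exists (val x).
  change (F [set y | ball (val x) e (val y)]); apply: filterS Fx => y.
  by rewrite -!ball_normE.
have lA : subspace_set A l.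
  apply: (closed_cvg (subspace_set A)) Fl; first exact: subspace_closed.
  by change (F [set x | subspace_set A (val x)]); apply: filterS filterT => x _;
    exact: subspace_set_val.
apply/cvg_ex; exists (to_subspace lA); apply/cvgrPdist_lt => e e0.
by have /cvgrPdist_lt /(_ e e0) := Fl.
Qed.

HB.instance Definition _ := Uniform_isComplete.Build (subspace_type A)
  subspace_complete.

End SubspaceComplete.

Lemma closure_approx (R : realType) (V : normedModType R) (D : set V) z
    (e : R) :
  closure D z -> 0 < e -> exists2 w, D w & `|z - w| < e.
Proof.
move=> zD e0; have [w [Dw zw]] := zD _ (nbhsx_ballx z e e0).
by exists w => //; move: zw; rewrite -ball_normE.
Qed.

(* It is enough that the real multiples are limits, so that [D] may be a
   countable set of rational combinations. *)
Lemma closure_subspaceP (R : realType) (V : normedModType R) (D : set V) :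
  D 0 -> (forall x y, D x -> D y -> D (x + y)) ->
  (forall (a : R) x, D x -> closure D (a *: x)) ->
  forall (a : R) x y, closure D x -> closure D y -> closure D (a *: x + y).
Proof.
move=> D0 DD DZ a x y xD yD.
move=> B /nbhs_ballP[e/= e0 eB].
have a0 : 0 < `|a| + 1 by rewrite ltr_wpDl.
have e4 : 0 < e / 4 by rewrite divr_gt0.
have [u Du xu] := closure_approx xD (divr_gt0 e4 a0).
have [v Dv yv] := closure_approx yD e4.
have [w Dw aw] := closure_approx (DZ a _ Du) e4.
exists (w + v); split; first exact: DD.
apply: eB; rewrite -ball_normE/=.
have -> : a *: x + y - (w + v) = a *: (x - u) + (a *: u - w) + (y - v).
  have -> : a *: (x - u) + (a *: u - w) = a *: x - w.
    by rewrite scalerBr addrA subrK.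
  by rewrite opprD addrACA.
apply: (le_lt_trans (ler_normD _ _)).
apply: (le_lt_trans (lerD (ler_normD _ _) (lexx _))); rewrite normrZ.
have : `|a| * `|x - u| <= e / 4.
  rewrite (le_trans (ler_wpM2l _ (ltW xu)))// mulrA ler_pdivrMr// mulrC.
  by rewrite ler_wpM2l ?divr_ge0 ?ltW// ltrDl.
lra.
Qed.

(** * Finite rank approximations in the dual *)

Lemma bounded_linear_of_le (R : realType) (X Z : normedModType R) (f : X -> Z)
    (M : R) : linear f -> (forall x, `|f x| <= M * `|x|) ->
  f \in bounded_linear X Z.
Proof.
move=> fl fM; apply/mem_set; split=> //.
pose fL : {linear X -> Z} := HB.pack f (GRing.isLinear.Build R X Z _ f fl).
apply: (@bounded_linear_continuous _ _ _ fL); apply/linear_boundedP.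
near=> r => x; rewrite (le_trans (fM x))// ler_wpM2r//.
by near: r; apply: nbhs_pinfty_ge; rewrite num_real.
Unshelve. all: by end_near. Qed.

Lemma boundedOp_sumE (R : realType) (X Z : normedModType R) (I : Type)
    (s : seq I) (P : pred I) (T : I -> boundedOp X Z) x :
  (\sum_(i <- s | P i) T i) x = \sum_(i <- s | P i) T i x.
Proof. by apply: (big_morph (fun T : boundedOp X Z => T x)). Qed.

(** Finite rank asks for the range to be exactly a span, not merely contained in one. Gaussian
    elimination: a vector [v] with nonzero first coordinate, if any, is split off, and induction
    treats the vectors that avoid [e ord0]. *)
Lemma finite_dim_subspaceS (R : realType) (X : normedModType R) (n : nat)
    (e : 'I_n -> X) (V : set X) : V 0 ->
  (forall a x y, V x -> V y -> V (a *: x + y)) ->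
  (forall v, V v -> exists c : 'I_n -> R, v = \sum_i c i *: e i) ->
  finite_dim_subspace V.
Proof.
elim: n e V => [|n IH] e V V0 VP Ve.
  exists 0%N, e; apply/seteqP.
  split=> [v /Ve[c ->]|_ [c _ <-]]; first by exists c.
  by rewrite big_ord0.
have [[v [c [Vv vc c0]]]|H] := pselect (exists v (c : 'I_n.+1 -> R),
    [/\ V v, v = \sum_i c i *: e i & c ord0 != 0]); last first.
  apply: (IH (fun i => e (lift ord0 i))) => // v Vv; have [c vc] := Ve v Vv.
  exists (fun i => c (lift ord0 i)); rewrite vc big_ord_recl.
  have [->|c0] := eqVneq (c ord0) 0; first by rewrite scale0r add0r.
  by exfalso; apply: H; exists v, c.
pose e1 i := e (lift ord0 i).
pose W := [set w | V w /\ exists c : 'I_n -> R, w = \sum_i c i *: e1 i].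
have [m [f Wf]] : finite_dim_subspace W.
  apply: (IH e1) => [|a x y|w []//].
    by split=> //; exists (fun=> 0); rewrite big1// => i _; rewrite scale0r.
  move=> [Vx [cx xc]] [Vy [cy yc]]; split; first exact: VP.
  exists (fun i => a * cx i + cy i); rewrite xc yc scaler_sumr -big_split/=.
  by apply: eq_bigr => i _; rewrite scalerDl scalerA.
exists m.+1, (fun i => oapp f v (unlift ord0 i)); apply/seteqP.
have sumE (d : 'I_m.+1 -> R) :
    \sum_i d i *: oapp f v (unlift ord0 i) =
    d ord0 *: v + \sum_i d (lift ord0 i) *: f i.
  rewrite big_ord_recl unlift_none/=; congr (_ + _).
  by apply: eq_bigr => i _; rewrite liftK.
split=> [x Vx|_ [d _ <-]]; last first.
  rewrite sumE; apply: VP => //.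
  suff : W (\sum_i d (lift ord0 i) *: f i) by case.
  by rewrite Wf; exists (fun i => d (lift ord0 i)).
have [b xb] := Ve x Vx; pose r := b ord0 / c ord0.
have : W (x - r *: v).
  split; first by rewrite addrC -scaleNr; exact: VP.
  exists (fun i => b (lift ord0 i) - r * c (lift ord0 i)).
  rewrite xb vc !big_ord_recl scalerDr scalerA /r divfK// opprD addrACA subrr.
  rewrite add0r scaler_sumr -sumrB; apply: eq_bigr => i _.
  by rewrite scalerBl scalerA.
rewrite Wf => -[d _ dx].
exists (fun i => oapp d r (unlift ord0 i)) => //; rewrite sumE unlift_none/=.
rewrite -[RHS](subrK (r *: v)) -dx addrC; congr (_ + _).
by apply: eq_bigr => i _; rewrite liftK.
Qed.

(** A cluster point, which exists by compactness of the segment, is a limit along an ultrafilter. *)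
Lemma ultra_bounded_cvg (R : realType) (T : Type) (F : set_system T)
    (g : T -> R) (B : R) : UltraFilter F -> F [set t | `|g t| <= B] ->
  exists l : R, g t @[t --> F] --> l.
Proof.
move=> FU gB; have : compact `[-B, B] by exact: segment_compact.
move=> /(_ (g @ F)) [|l [_ lF]].
  change (F [set t | g t \in `[-B, B]]); apply: filterS gB => t /=.
  by rewrite in_itv/= -ler_norml.
exists l => N lN; have [//|FN] := in_ultra_setVsetC (g @^-1` N) FU.
have [x [gx Nx]] := lF (~` N) N FN lN; by [].
Qed.

Section Witness.
Context {R : realType} {X : normedModType R}.

(** The rank [k] operator sending [f] to the sum of the [f (xi i) * phi i], tested on [c] at points
    of [s]. Linearity of [phi i] is tested on [s] only, so that the condition can pass to a limit
    over finite sets. *)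
Definition approximates (k : nat) (B : R) (c : nat -> dual_space X) (eps : R)
    (s : set X) (phi : 'I_k -> X -> R) (xi : 'I_k -> X) : Prop :=
  [/\ forall i a x y, s x -> s y -> phi i (a *: x + y) = a * phi i x + phi i y,
    forall i x, `|phi i x| <= `|x|,
    forall i, `|xi i| <= B &
    forall x n, s x ->
      `|\sum_i (c n (xi i) : R) * phi i x - c n x| <= eps * `|x|].

(* Tychonoff: approximations of rank [k] over all the finite sets, uniformly
   bounded, have a limit, with the vectors [xi i] becoming elements of the
   bidual. *)
Lemma approximates_finite_rank (k : nat) (B : R) (c : nat -> dual_space X)
    (eps : R) :
  0 <= eps ->
  (forall s : seq X, exists phi xi, @approximates k B c eps [set` s] phi xi) ->
  exists2 T : boundedOp (dual_space X) (dual_space X), finite_rank T &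
    forall n, `|c n - T (c n)| <= eps.
Proof.
move=> eps0 H.
have /choice[p pP] : forall s : seq X,
    exists p : ('I_k -> X -> R) * ('I_k -> X),
    approximates B c eps [set` s] p.1 p.2.
  by move=> s; have [phi [xi ?]] := H s; exists (phi, xi).
(* The filter of eventual properties of finite sets ordered by inclusion; each point eventually
   belongs to the set. *)
pose F : set_system (seq X) :=
  [set S : set (seq X) | exists s0 : seq X, forall s : seq X,
    {subset s0 <= s} -> S s].
have FF : ProperFilter F.
  apply: Build_ProperFilter_ex => [S [s0 Ss0]|]; first by exists s0; exact: Ss0.
  split=> [|S1 S2 [s1 A1] [s2 B2]|S1 S2 S12 [s0 As0]]; first by exists [::].
    exists (s1 ++ s2) => s s12; split.
      by apply: A1 => x xs; apply: s12; rewrite mem_cat xs.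
    by apply: B2 => x xs; apply: s12; rewrite mem_cat xs orbT.
  by exists s0 => s /As0/S12.
have [G [GU FG]] := ultraFilterLemma FF.
have GP : ProperFilter G by exact: ultra_proper.
have Gmem (x : X) : G [set s : seq X | x \in s].
  by apply: FG; exists [:: x] => s sx; apply: sx; rewrite inE.
have /choice[phi phiP] : forall ix : 'I_k * X, exists l : R,
    (p s).1 ix.1 ix.2 @[s --> G] --> l.
  move=> [i x]; apply: (@ultra_bounded_cvg _ _ _ _ `|x|); near=> s.
  by have [_ + _ _] := pP s; exact.
have /choice[xi xiP] : forall ix : 'I_k * dual_space X, exists l : R,
    (ix.2 ((p s).2 ix.1) : R) @[s --> G] --> l.
  move=> [i f]; apply: (@ultra_bounded_cvg _ _ _ _ (`|f| * B)); near=> s.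
  have [_ _ + _] := pP s => /(_ i) pk; apply: (le_trans (opnormP f _)).
  by apply: ler_wpM2l => //; exact: opnorm_ge0.
have phil i : linear (fun x => phi (i, x) : R^o).
  move=> a x y.
  apply: (@cvg_unique _ _ ((fun s => (p s).1 i (a *: x + y)) @ G)).
  - exact: Rhausdorff.
  - exact: phiP (i, _).
  - have lim2 : (a * (p s).1 i x + (p s).1 i y) @[s --> G] -->
        a * phi (i, x) + phi (i, y).
      apply: cvgD; last exact: phiP (i, y).
      by apply: cvgM; [exact: cvg_cst|exact: phiP (i, x)].
    apply: cvg_trans lim2; apply: near_eq_cvg; near=> s.
    have [+ _ _ _] := pP s => /(_ i a x y) ->//; near: s; exact: Gmem.
have phiB i x : `|phi (i, x) : R^o| <= 1 * `|x|.
  have cg : `|(p s).1 i x| @[s --> G] --> `|phi (i, x)|.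
    exact: cvg_norm (phiP (i, x)).
  apply: (closed_cvg (fun r => r <= 1 * `|x|)) cg; first exact: closed_le.
  by near=> s; rewrite mul1r; have [_ + _ _] := pP s; exact.
have xil i a f g : xi (i, a *: f + g) = a * xi (i, f) + xi (i, g).
  apply: (@cvg_unique _ _ ((fun s => (a *: f + g) ((p s).2 i) : R) @ G)).
  - exact: Rhausdorff.
  - exact: xiP (i, _).
  - apply: (cvgD (f := fun s => a * (f ((p s).2 i) : R))); last first.
      exact: xiP (i, g).
    by apply: cvgM; [exact: cvg_cst|exact: xiP (i, f)].
have xiB i f : `|xi (i, f)| <= `|f| * B.
  have cg : `|f ((p s).2 i) : R| @[s --> G] --> `|xi (i, f)|.
    exact: cvg_norm (xiP (i, f)).
  apply: (closed_cvg (fun r => r <= `|f| * B)) cg; first exact: closed_le.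
  near=> s; have [_ _ + _] := pP s => /(_ i) pk.
  by apply: (le_trans (opnormP f _)); apply: ler_wpM2l => //; exact: opnorm_ge0.
pose Phi i : dual_space X := BoundedOp (bounded_linear_of_le (phil i) (phiB i)).
pose T f : dual_space X := \sum_i xi (i, f) *: Phi i.
have Tl : linear T.
  move=> a f g; rewrite /T scaler_sumr -big_split/=; apply: eq_bigr => i _.
  by rewrite xil scalerDl scalerA.
have TB f : `|T f| <= (\sum_i B * `|Phi i|) * `|f|.
  rewrite mulr_suml; apply: (le_trans (ler_norm_sum _ _ _)).
  apply: ler_sum => i _.
  by rewrite normrZ mulrAC [B * _]mulrC ler_wpM2r.
exists (BoundedOp (bounded_linear_of_le Tl TB)).
  apply: (@finite_dim_subspaceS _ _ k Phi).
  - by exists 0 => //; rewrite linear0.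
  - move=> a _ _ [f _ <-] [g _ <-]; exists (a *: f + g) => //.
    by rewrite linearP.
  - by move=> _ [f _ <-]; exists (fun i => xi (i, f)).
move=> n; apply: opnorm_le => x x1; rewrite distrC.
apply: (@le_trans _ _ (eps * `|x|)); last by rewrite ler_piMr.
rewrite -[X in `|X|]/((T (c n)) x - c n x) /T boundedOp_sumE.
have cg : `|\sum_i (c n ((p s).2 i) : R) * (p s).1 i x - c n x| @[s --> G] -->
    `|\sum_i xi (i, c n) * phi (i, x) - c n x|.
  apply: cvg_norm; apply: cvgB; last exact: cvg_cst.
  apply: cvg_big => [|i _]; first exact: add_continuous.
  exact: cvgM (xiP (i, c n)) (phiP (i, x)).
apply: (closed_cvg (fun r => r <= eps * `|x|)) cg; first exact: closed_le.
by near=> s; have [_ _ _] := pP s; apply; near: s; exact: Gmem.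
Unshelve. all: by end_near. Qed.

End Witness.

(** The net is an initial stretch of the sequence, so that only finitely many coordinates have to be
    controlled later. *)
Definition totally_bounded_seq (R : realType) (E : normedModType R)
    (c : nat -> E) : Prop :=
  forall d : R, 0 < d -> exists m : nat, forall n, exists2 i, (i < m)%N &
    `|c n - c i| < d.

Lemma compact_net (R : realType) (E : normedModType R) (C : set E) (d : R) :
  compact C -> 0 < d -> exists2 s : seq E, forall y, y \in s -> C y &
    forall x, C x -> exists2 y, y \in s & `|x - y| < d.
Proof.
rewrite compact_cover => Cc d0.
have [||D DC CD] := Cc E C (fun y => ball y d).
- by move=> y _; exact: ball_open.
- by move=> x Cx; exists x => //; exact: ballxx.
exists (finmap.enum_fset D) => [y yD|x /CD[y yD]].
  exact: set_mem (DC y yD).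
by rewrite -ball_normE/= distrC => xy; exists y.
Qed.

(** The sequence runs through finite nets of a bad compact set, of mesh [1 / k.+1]. A point badly
    approximated by [T] has a net point nearby that is still badly approximated, at the cost of
    halving [eps]. *)
Lemma not_approximation_property_seq (R : realType)
    (E : completeNormedModType R) : ~ approximation_property E ->
  exists (c : nat -> E) (eps : R), [/\ 0 < eps, totally_bounded_seq c &
    forall T : boundedOp E E, finite_rank T ->
      exists n, eps < `|c n - T (c n)|].
Proof.
move=> nAP.
have [C [eps [Cc eps0 CT]]] : exists (C : set E) (eps : R), [/\ compact C,
    0 < eps & forall T : boundedOp E E, finite_rank T ->
      exists2 x, C x & eps <= `|x - T x|].
  apply: contrapT => H; apply: nAP => C eps Cc eps0; apply: contrapT => H'.
  apply: H; exists C, eps; split=> // T Tf; apply: contrapT => H''; apply: H'.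
  exists T => // x Cx; rewrite ltNge; apply/negP => xT; apply: H''.
  by exists x.
have /choice[s sP] : forall k : nat, exists s : seq E,
    (forall y, y \in s -> C y) /\
    forall x, C x -> exists2 y, y \in s & `|x - y| < k.+1%:R^-1.
  by move=> k; have [|s s1 s2] := @compact_net _ _ C k.+1%:R^-1 Cc;
    [rewrite invr_gt0|exists s].
pose c n : E := if unpickle n is Some ki then (s ki.1)`_ki.2 else 0.
have cC n : c n = 0 \/ C (c n).
  rewrite /c; case: unpickle => [[k i]|]/=; last by left.
  have [ik|ki] := ltnP i (size (s k)); last by left; rewrite nth_default.
  by right; apply: (sP k).1; exact: mem_nth.
have c0 k i : c (pickle (k, i)) = (s k)`_i by rewrite /c pickleK.
exists c, (eps / 2); split; first by rewrite divr_gt0.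
  move=> d d0; have [k kd] := ltr_invS_ex d0.
  (* The extra index [size (s k)] codes the default value [0], so that the terms equal to [0] are
     covered too. *)
  exists (\max_(i < (size (s k)).+1) pickle (k, val i)).+1 => n.
  have lem (i : 'I_(size (s k)).+1) : (pickle (k, val i) <
      (\max_(i < (size (s k)).+1) pickle (k, val i)).+1)%N.
    pose f (i : 'I_(size (s k)).+1) := pickle (k, val i).
    by rewrite ltnS (@leq_bigmax _ f).
  have [->|Cn] := cC n.
    exists (pickle (k, val (@ord_max (size (s k))))) => //.
    by rewrite c0 nth_default// subrr normr0.
  have [y ys ny] := (sP k).2 _ Cn.
  have ik : (index y (s k) < (size (s k)).+1)%N by rewrite ltnS index_size.
  exists (pickle (k, val (Ordinal ik))) => //.
  by rewrite c0/= nth_index// (lt_trans ny).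
move=> T Tf; have [x Cx xT] := CT T Tf; apply: contrapT => H.
(* Moving from [x] to [y] changes [x - T x] by at most [(1 + |T|) * |x - y|]. *)
have d0 : 0 < eps / 2 / (1 + `|T|) by rewrite !divr_gt0// ltr_wpDr.
have [k kd] := ltr_invS_ex d0.
have [y ys xy] := (sP k).2 _ Cx.
have yT : `|y - T y| <= eps / 2.
  rewrite leNgt; apply/negP => yT; apply: H.
  by exists (pickle (k, index y (s k))); rewrite c0 nth_index.
have := lt_trans xy kd; rewrite ltr_pdivlMr ?ltr_wpDr// => {}xy.
have h : `|T (y - x)| <= `|T| * `|x - y| by rewrite distrC; exact: opnormP.
have : `|x - T x| <= `|x - y| + `|y - T y| + `|T (y - x)|.
  rewrite (_ : x - T x = (x - y) + (y - T y) + T (y - x)).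
    by rewrite (le_trans (ler_normD _ _))// lerD2r ler_normD.
  by rewrite linearB !addrA !subrK.
rewrite mulrDr mulr1 [X in _ + X]mulrC in xy.
by move: h; move: (`|T| * _) xy => u; lra.
Qed.

(** * Rotund renormings *)

(** Minkowski's inequality in the plane; the cross terms are compared by Cauchy-Schwarz. *)
Lemma sqrt_minkowski (R : rcfType) (a b c d x y : R) :
  0 <= a -> 0 <= b -> 0 <= x -> x <= a + b -> `|y| <= `|c| + `|d| ->
  Num.sqrt (x ^+ 2 + y ^+ 2) <=
    Num.sqrt (a ^+ 2 + c ^+ 2) + Num.sqrt (b ^+ 2 + d ^+ 2).
Proof.
move=> a0 b0 x0 xab ycd.
have pos (u v : R) : 0 <= u ^+ 2 + v ^+ 2 by rewrite addr_ge0 ?sqr_ge0.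
have s0 := sqrtr_ge0 (a ^+ 2 + c ^+ 2); have t0 := sqrtr_ge0 (b ^+ 2 + d ^+ 2).
have sE := sqr_sqrtr (pos a c); have tE := sqr_sqrtr (pos b d).
move: (Num.sqrt (a ^+ 2 + c ^+ 2)) (Num.sqrt (b ^+ 2 + d ^+ 2)) s0 t0 sE tE.
move=> s t s0 t0 sE tE.
rewrite -[leRHS]ger0_norm ?addr_ge0// -sqrtr_sqr ler_wsqrtr//.
have h1 : x ^+ 2 <= (a + b) ^+ 2 by rewrite lerXn2r// nnegrE ?addr_ge0.
have h2 : y ^+ 2 <= (`|c| + `|d|) ^+ 2.
  by rewrite -[y ^+ 2]real_normK ?num_real// lerXn2r// nnegrE ?addr_ge0.
have cE : `|c| ^+ 2 = c ^+ 2 by rewrite real_normK ?num_real.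
have dE : `|d| ^+ 2 = d ^+ 2 by rewrite real_normK ?num_real.
have h3 : a * b + `|c| * `|d| <= s * t.
  have st0 : 0 <= s * t by exact: mulr_ge0.
  have ab0 : 0 <= a * b + `|c| * `|d| by rewrite addr_ge0 ?mulr_ge0.
  rewrite -(@ler_pXn2r _ 2)// ?nnegrE// exprMn sE tE -cE -dE.
  have := sqr_ge0 (a * `|d| - b * `|c|); lra.
have : s ^+ 2 = a ^+ 2 + `|c| ^+ 2 by rewrite cE.
have : t ^+ 2 = b ^+ 2 + `|d| ^+ 2 by rewrite dE.
lra.
Qed.

Section StrictlyConvex.
Context {R : realType} {V : normedModType R} (h : nat -> V -> R).
Hypothesis hl : forall n, norm_le_linear (h n).

Let u (n : nat) : R := (2 ^+ n.+1)^-1.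

(** A Euclidean sum of the norm and the first [n] weighted coordinates; adding them one at a time
    reduces the triangle inequality to the plane. *)
Fixpoint sqrt_norm (n : nat) (v : V) : R :=
  if n is m.+1 then Num.sqrt (sqrt_norm m v ^+ 2 + (u m * h m v) ^+ 2)
  else `|v|.

Let u0 n : 0 < u n. Proof. by rewrite invr_gt0 exprn_gt0. Qed.

Lemma sqrt_norm_ge0 n v : 0 <= sqrt_norm n v.
Proof. by case: n => [|n]/=; rewrite ?sqrtr_ge0 ?normr_ge0. Qed.

Lemma sqrt_normSE n v : sqrt_norm n.+1 v ^+ 2 =
  sqrt_norm n v ^+ 2 + (u n * h n v) ^+ 2.
Proof. by rewrite /= sqr_sqrtr// addr_ge0 ?sqr_ge0. Qed.

Lemma sqrt_normS n v : sqrt_norm n v <= sqrt_norm n.+1 v.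
Proof.
rewrite -(@ler_pXn2r _ 2)// ?nnegrE ?sqrt_norm_ge0// sqrt_normSE.
by rewrite lerDl sqr_ge0.
Qed.

Lemma sqrt_norm_homo v : {homo sqrt_norm^~ v : m n / (m <= n)%N >-> m <= n}.
Proof.
by apply: homo_leq => [//|? ? ?|n]; [exact: le_trans|exact: sqrt_normS].
Qed.

Lemma sqrt_norm_le n v : sqrt_norm n v <= 2 * `|v|.
Proof.
(* Since [u m ^+ 2 <= u m], the factor is [1] plus the sum of the [u m] for [m < n], which equals
   [1 - 2 * u n]. *)
suff H : sqrt_norm n v ^+ 2 <= (2 - 2 * u n) * `|v| ^+ 2.
  rewrite -(@ler_pXn2r _ 2)// ?nnegrE ?sqrt_norm_ge0 ?mulr_ge0//.
  apply: (le_trans H); rewrite exprMn ler_wpM2r ?sqr_ge0//.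
  by have := u0 n; lra.
elim: n => [|n IH]; first by rewrite /= /u expr1 mulfV ?pnatr_eq0//; lra.
rewrite sqrt_normSE; apply: (le_trans (lerD IH (lexx _))).
have uS : u n = 2 * u n.+1.
  by rewrite /u [in RHS]exprS invfM mulrA mulfV ?pnatr_eq0// mul1r.
have un1 : u n <= 1 by rewrite invf_le1 ?exprn_gt0// exprn_ege1// ler1n.
have h2 : (h n v) ^+ 2 <= `|v| ^+ 2.
  rewrite -[h n v ^+ 2]real_normK ?num_real// lerXn2r// ?nnegrE//.
  exact: norm_le_linear_abs.
have h3 : (u n) ^+ 2 * h n v ^+ 2 <= u n * `|v| ^+ 2.
  by apply: ler_pM; rewrite ?sqr_ge0// expr2 ler_piMl// ltW.
rewrite exprMn; move: (`|v| ^+ 2) (u n ^+ 2 * _) h3 => a b.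
by rewrite uS; move: (u n.+1) => w; lra.
Qed.

Lemma sqrt_normD n v w : sqrt_norm n (v + w) <= sqrt_norm n v + sqrt_norm n w.
Proof.
elim: n => [|n IH] /=; first exact: ler_normD.
apply: sqrt_minkowski; rewrite ?sqrt_norm_ge0//.
by rewrite (norm_le_linearD (hl n)) mulrDr ler_normD.
Qed.

Lemma sqrt_normZ n a v : sqrt_norm n (a *: v) = `|a| * sqrt_norm n v.
Proof.
elim: n => [|n IH] /=; first exact: normrZ.
rewrite IH (norm_le_linearZ (hl n)) mulrCA !exprMn real_normK ?num_real//.
by rewrite -mulrDr sqrtrM ?sqr_ge0// sqrtr_sqr.
Qed.

(** The coordinates satisfy the parallelogram identity exactly, while the norm satisfies half of it
    by convexity; the term in [h i w] is what remains of the identity. *)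
Lemma sqrt_norm_parallelogram i n v w : (i < n)%N ->
  2 * sqrt_norm n v ^+ 2 + 2 * (u i * h i w) ^+ 2 <=
  sqrt_norm n (v + w) ^+ 2 + sqrt_norm n (v - w) ^+ 2.
Proof.
have hE m : (u m * h m (v + w)) ^+ 2 + (u m * h m (v - w)) ^+ 2 =
    2 * (u m * h m v) ^+ 2 + 2 * (u m * h m w) ^+ 2.
  by rewrite (norm_le_linearD (hl m)) (norm_le_linearB (hl m)); ring.
have weak m : 2 * sqrt_norm m v ^+ 2 <=
    sqrt_norm m (v + w) ^+ 2 + sqrt_norm m (v - w) ^+ 2.
  elim: m => [|m IH] /=.
    have : 2 * `|v| <= `|v + w| + `|v - w|.
      have := ler_normD (v + w) (v - w); rewrite addrACA subrr addr0 -mulr2n.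
      by rewrite -scaler_nat normrZ normr_nat.
    have := normr_ge0 v; move: `|v| `|v + w| `|v - w| => a b c a0 abc.
    have := sqr_ge0 (b - c).
    have : (2 * a) ^+ 2 <= (b + c) ^+ 2.
      by rewrite lerXn2r// nnegrE; lra.
    lra.
  rewrite !sqrt_normSE; have := hE m; have := sqr_ge0 (u m * h m w); lra.
elim: n => // n IH; rewrite ltnS leq_eqVlt => /predU1P[->|/IH {}IH];
  rewrite !sqrt_normSE; have := hE n.
  by have := weak n; lra.
by have := sqr_ge0 (u n * h n w); lra.
Qed.

(* Adding the Hilbertian part [(h n v) / 2^(n+1)] makes the norm satisfy half
   of the parallelogram inequality, with a remainder that separates points. *)
Lemma strictly_convex_renorming : exists N : equiv_norm V,
  (forall v, `|v| <= N v <= 2 * `|v|) /\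
  forall v w, N (v + w) <= N v -> N (v - w) <= N v -> forall n, h n w = 0.
Proof.
pose E v : set R := [set sqrt_norm n v | n in setT].
pose q v := sup (E v).
have Esup v : has_sup (E v).
  split; first by exists (sqrt_norm 0%N v); exists 0%N.
  by exists (2 * `|v|) => _ [n _ <-]; exact: sqrt_norm_le.
have qge v n : sqrt_norm n v <= q v.
  by apply: (ub_le_sup (Esup v).2); exists n.
have qle v M : (forall n, sqrt_norm n v <= M) -> q v <= M.
  by move=> H; apply: ge_sup; [exact: (Esup v).1|move=> _ [n _ <-]].
have qD x y : q (x + y) <= q x + q y.
  by apply: qle => n; rewrite (le_trans (sqrt_normD _ _ _))// lerD.
have qZle a x : q (a *: x) <= `|a| * q x.
  by apply: qle => n; rewrite sqrt_normZ ler_wpM2l.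
have q0 x : 0 <= q x by rewrite (le_trans _ (qge x 0%N))//= normr_ge0.
have qZ a x : q (a *: x) = `|a| * q x.
  apply/eqP; rewrite eq_le qZle/=.
  have [->|a0] := eqVneq a 0; first by rewrite normr0 mul0r.
  by have := qZle a^-1 (a *: x); rewrite scalerA mulVf// scale1r normfV
    ler_pdivlMl ?normr_gt0.
have qn v : `|v| <= q v <= 2 * `|v|.
  by rewrite (qge v 0%N) qle// => n; exact: sqrt_norm_le.
have qequiv : exists m M : R, [/\ 0 < m, 0 < M &
    forall x, m * `|x| <= q x <= M * `|x|].
  by exists 1, 2; split=> // x; rewrite mul1r.
exists (EquivNorm qD qZ qequiv); split=> //= v w vw vw' n.
pose k := u n * h n w.
(* The deficit [k ^+ 2] is the same for all [m > n], so it survives in the supremum [q v] and forces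
   [k = 0]. *)
have kN m : (n < m)%N -> sqrt_norm m v ^+ 2 <= q v ^+ 2 - k ^+ 2.
  move=> nm; have := sqrt_norm_parallelogram v w nm; rewrite -/k.
  have : sqrt_norm m (v + w) ^+ 2 <= q v ^+ 2.
    by rewrite lerXn2r ?nnegrE ?sqrt_norm_ge0// (le_trans (qge _ _)).
  have : sqrt_norm m (v - w) ^+ 2 <= q v ^+ 2.
    by rewrite lerXn2r ?nnegrE ?sqrt_norm_ge0// (le_trans (qge _ _)).
  lra.
have pos : 0 <= q v ^+ 2 - k ^+ 2 by rewrite (le_trans _ (kN n.+1 _))// sqr_ge0.
have : q v <= Num.sqrt (q v ^+ 2 - k ^+ 2).
  apply: qle => m.
  apply: (@le_trans _ _ (sqrt_norm (maxn m n.+1) v)).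
    by apply: sqrt_norm_homo; exact: leq_maxl.
  rewrite -[leLHS]ger0_norm ?sqrt_norm_ge0// -sqrtr_sqr ler_wsqrtr//.
  by apply: kN; exact: leq_maxr.
rewrite -(@ler_pXn2r _ 2)// ?nnegrE ?sqrtr_ge0// sqr_sqrtr// => h1.
have /eqP : k ^+ 2 = 0 by apply/eqP; rewrite eq_le sqr_ge0 andbT; lra.
by rewrite sqrf_eq0 mulf_eq0 gt_eqF//= => /eqP.
Qed.

End StrictlyConvex.

(** * Bounded sequences and compact operators *)

Definition bounded_seq_pred (R : realType) : {pred nat -> R^o} :=
  mem [set f : nat -> R^o | exists M : R, forall n, `|f n : R| <= M].

Arguments bounded_seq_pred : clear implicits.

Record bounded_seq (R : realType) := BoundedSeq {
  bounded_seq_fun :> nat -> R^o;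
  _ : bounded_seq_fun \in bounded_seq_pred R }.

Section BoundedSeqNormed.
Context {R : realType}.

HB.instance Definition _ := [isSub for @bounded_seq_fun R].
HB.instance Definition _ := [Choice of bounded_seq R by <:].

Lemma bounded_seq_submod_closed : submod_closed (bounded_seq_pred R).
Proof.
split=> [|a f g /set_mem[M fM] /set_mem[N gN]]; apply/mem_set.
  by exists 0 => n; rewrite normr0.
exists (`|a| * M + N) => n; apply: (le_trans (ler_normD (a * f n) (g n))).
by rewrite normrM lerD// ler_wpM2l.
Qed.

HB.instance Definition _ := GRing.isSubmodClosed.Build _ _
  (bounded_seq_pred R) bounded_seq_submod_closed.
HB.instance Definition _ := [SubChoice_isSubLmodule of bounded_seq R by <:].

Definition sup_norm (f : bounded_seq R) : R := sup [set `|f n : R| | n in setT].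

Lemma sup_norm_ge (f : bounded_seq R) n : `|f n : R| <= sup_norm f.
Proof.
apply: ub_le_sup; last by exists n.
by have /set_mem[M fM] := valP f; exists M => _ [m _ <-]; exact: fM.
Qed.

Lemma sup_norm_le (f : bounded_seq R) M :
  (forall n, `|f n : R| <= M) -> sup_norm f <= M.
Proof.
move=> fM; apply: ge_sup; last by move=> _ [m _ <-].
by exists `|f 0%N : R|; exists 0%N.
Qed.

Lemma sup_normD f g : sup_norm (f + g) <= sup_norm f + sup_norm g.
Proof.
apply: sup_norm_le => n; apply: (le_trans (ler_normD (f n : R) (g n))).
by rewrite lerD// sup_norm_ge.
Qed.

Lemma sup_normZ a f : sup_norm (a *: f) = `|a| * sup_norm f.
Proof.
have le b g : sup_norm (b *: g) <= `|b| * sup_norm g.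
  apply: sup_norm_le => n; rewrite [leLHS](normrM b (g n)).
  by rewrite ler_wpM2l// sup_norm_ge.
apply/eqP; rewrite eq_le le/=.
have [->|a0] := eqVneq a 0.
  by rewrite normr0 mul0r (le_trans _ (sup_norm_ge _ 0%N)).
have := le a^-1 (a *: f); rewrite scalerA mulVf// scale1r normfV.
by rewrite ler_pdivlMl ?normr_gt0.
Qed.

Lemma sup_norm_eq0 f : sup_norm f = 0 -> f = 0.
Proof.
move=> f0; apply/val_inj/funext => n; apply/eqP; rewrite -normr_le0 -f0.
exact: sup_norm_ge.
Qed.

HB.instance Definition _ := Lmodule_isNormed.Build R (bounded_seq R)
  sup_normD sup_normZ sup_norm_eq0.

Lemma bounded_seq_complete (F : set_system (bounded_seq R)) :
  ProperFilter F -> cauchy F -> cvg F.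
Proof.
move=> FF Fc; have Fex : cauchy_ex F by apply/cauchyP.
have Fn n : cvg ((fun f : bounded_seq R => f n : R^o) @ F).
  apply: cauchy_cvg; apply: cauchy_exP => e e0.
  have [f Ff] := Fex _ e0; exists (f n).
  change (F [set g | ball (f n) e (g n)]); apply: filterS Ff => g.
  rewrite -!ball_normE/=; apply: le_lt_trans.
  exact: (sup_norm_ge (f - g) n).
pose l n : R^o := lim ((fun f : bounded_seq R => f n : R^o) @ F).
have lF e f n : F (ball f e) -> `|l n - f n : R| <= e.
  move=> Ff; have cg : (fun g : bounded_seq R => `|g n - f n : R|) @ F -->
      `|l n - f n : R|.
    by apply: cvg_norm; apply: cvgB; [exact: Fn|exact: cvg_cst].
  apply: (closed_cvg (fun r => r <= e)) cg; first exact: closed_le.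
  change (F [set g : bounded_seq R | `|g n - f n : R| <= e]).
  apply: filterS Ff => g; rewrite -ball_normE/= => fg.
  by rewrite distrC (le_trans (sup_norm_ge (f - g) n))// ltW.
have lB : l \in bounded_seq_pred R.
  apply/mem_set; have [f Ff] := Fex _ ltr01; exists (1 + sup_norm f) => n.
  rewrite -[l n](subrK (f n)) (le_trans (ler_normD (l n - f n : R) (f n)))//.
  by rewrite lerD// ?sup_norm_ge// lF.
apply/cvg_ex; exists (BoundedSeq lB); apply/cvgrPdist_le => e e0.
have e20 : 0 < e / 2 by rewrite divr_gt0.
have [f Ff] := Fex _ e20; near=> g.
rewrite -[_ - g](subrKA f) (le_trans (ler_normD _ _))// (splitr e) lerD//.
  by apply: sup_norm_le => n; exact: lF.
have : ball f (e / 2) g by near: g.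
by rewrite -ball_normE/= => /ltW.
Unshelve. all: by end_near. Qed.

HB.instance Definition _ := Uniform_isComplete.Build (bounded_seq R)
  bounded_seq_complete.

Lemma bounded_seq_linearE a (f g : bounded_seq R) n :
  (a *: f + g) n = a * f n + g n :> R.
Proof. by []. Qed.

Lemma bounded_seq_normE (f : bounded_seq R) : `|f| = sup_norm f.
Proof. by []. Qed.

End BoundedSeqNormed.

Lemma totally_bounded_seq_bounded (R : realType) (E : normedModType R)
    (c : nat -> E) : totally_bounded_seq c ->
  exists M : R, forall n, `|c n| <= M.
Proof.
move=> /(_ 1 ltr01)[m cm]; exists (\sum_(i < m) `|c i| + 1) => n.
have [i im ni] := cm n.
have h1 : `|c i| <= \sum_(i < m) `|c i|.
  by rewrite (bigD1 (Ordinal im))//= lerDl; apply: sumr_ge0.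
have := ler_normD (c n - c i) (c i); rewrite subrK; lra.
Qed.

(* Arzela-Ascoli: the coordinates [h n] that compute the norm of [Z] are
   precompact on the image of the ball. *)
Lemma compact_operators_coordinates (R : realType) (X : normedModType R)
    (Z : completeNormedModType R) (h : nat -> Z -> R) (T : boundedOp X Z) :
  (forall n, norm_le_linear (h n)) ->
  (forall z (e : R), (forall n, `|h n z| <= e) -> `|z| <= 2 * e) ->
  (forall d : R, 0 < d -> exists m : nat, forall n, exists2 i, (i < m)%N &
     forall x, `|x| <= 1 -> `|h n (T x) - h i (T x)| <= d) ->
  compact_operators X Z T.
Proof.
move=> hl h2 hT; rewrite /compact_operators/= precompactE compact_ultra.
set K := closure _ => U UU UK.
have UP : ProperFilter U by exact: ultra_proper.
have KT z (e : R) : K z -> 0 < e -> exists2 x, `|x| <= 1 & `|z - T x| < e.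
  by move=> Kz e0; have [_ [x x1 <-] zx] := closure_approx Kz e0; exists x.
have KB i z : K z -> `|h i z| <= `|T| + 1.
  move=> /KT /(_ ltr01)[x x1 zx].
  have Tx : `|T x| <= `|T| by exact: opnorm_ge.
  have := ler_normD (z - T x) (T x); rewrite subrK.
  have := norm_le_linear_abs (hl i) z; lra.
have Kd (d : R) : 0 < d -> exists m : nat, forall n, exists2 i, (i < m)%N &
     forall z, K z -> `|h n z - h i z| <= d.
  move=> d0; have [|m Hm] := hT (d / 2); first by rewrite divr_gt0.
  exists m => n; have [i im Hi] := Hm n; exists i => // z /KT.
  move=> /(_ (d / 4)) [|x x1 zx]; first by rewrite divr_gt0.
  have h0 := Hi x x1; have hn := norm_le_linear_abs (hl n) (z - T x).
  have hi := norm_le_linear_abs (hl i) (z - T x).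
  rewrite (norm_le_linearB (hl n)) in hn.
  rewrite (norm_le_linearB (hl i)) in hi.
  have -> : h n z - h i z =
      (h n z - h n (T x)) + (h n (T x) - h i (T x)) - (h i z - h i (T x)).
    ring.
  rewrite (le_trans (ler_normB _ _))//.
  have := ler_normD (h n z - h n (T x)) (h n (T x) - h i (T x)); lra.
have /choice[l lP] : forall i, exists l : R, h i z @[z --> U] --> l.
  move=> i; apply: (@ultra_bounded_cvg _ _ _ _ (`|T| + 1)).
  by apply: filterS UK => z; exact: KB.
have /cvg_ex[p Up] : cvg U.
  apply: cauchy_cvg; apply: cauchy_exP => e e0.
  have d0 : 0 < e / 16 by rewrite divr_gt0.
  have [m Km] := Kd _ d0.
  (* Control of [m] coordinates controls all of them: four errors of [e / 16] give [e / 4], and [h2]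
     doubles it. *)
  pose W := [set z | K z /\ forall i : 'I_m, `|l i - h i z| < e / 16].
  have UW : U W.
    apply: filterI => //; apply: filter_forall => i.
    by have /cvgrPdist_lt /(_ _ d0) := lP i.
  have [z0 [K0 W0]] := filter_ex UW; exists z0; apply: filterS UW => z [Kz Wz].
  rewrite -ball_normE/=; apply: (@le_lt_trans _ _ (2 * (e / 4))); last by lra.
  apply: h2 => n; rewrite (norm_le_linearB (hl n)).
  have [i im Hi] := Km n; have := Hi _ Kz; have := Hi _ K0.
  have := Wz (Ordinal im); have := W0 (Ordinal im) => /=.
  rewrite ler_distlC ltr_distlC ltr_distlC ler_distlC ler_distlC.
  move=> /andP[a1 a2] /andP[b1 b2] /andP[c1 c2] /andP[e1 e2].
  by apply/andP; split; lra.
exists p; split=> //; apply: (closed_cvg K) Up => //; exact: closed_closure.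
Qed.

(** * Operators attaining their norm *)

Lemma linear_common_kernel (R : realType) (Y : normedModType R)
    (Z : lmodType R) (n : nat) (F : nat -> Y -> R) (S : Y -> Z) :
  (forall j, norm_le_linear (F j)) -> linear S ->
  (forall y, (forall j, (j < n)%N -> F j y = 0) -> S y = 0) ->
  exists w : nat -> Y, forall y, S y = \sum_(j < n) F j y *: S (w j).
Proof.
move=> Fl; elim: n S => [|n IH] S Sl S0.
  by exists (fun=> 0) => y; rewrite big_ord0 S0.
have SB x y : S (x - y) = S x - S y.
  by rewrite -[y in LHS]scale1r -scaleNr addrC Sl scaleN1r addrC.
have S00 : S 0 = 0 by rewrite -(subrr 0) SB subrr.
have SZ a x : S (a *: x) = a *: S x by rewrite -[a *: x]addr0 Sl S00 addr0.
have [[e [Fe en]]|H] := pselect (exists e, F n e = 1 /\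
    forall j, (j < n)%N -> F j e = 0).
  pose P y := y - F n y *: e.
  have PF j y : (j < n)%N -> F j (P y) = F j y.
    move=> jn; rewrite (norm_le_linearB (Fl j)) (norm_le_linearZ (Fl j)) en//.
    by rewrite mulr0 subr0.
  have Pl : linear (S \o P).
    move=> a x y /=; rewrite -Sl; congr S.
    rewrite /P (Fl n).1 scalerDl -scalerA.
    by rewrite opprD scalerBr addrACA.
  have [|w wS] := IH (S \o P) Pl.
    move=> y yF; apply: S0 => j; rewrite ltnS leq_eqVlt => /predU1P[->|jn].
      rewrite (norm_le_linearB (Fl n)) (norm_le_linearZ (Fl n)).
      by rewrite Fe mulr1 subrr.
    by rewrite PF// yF.
  exists (fun j => if j == n then e else P (w j)) => y.
  rewrite big_ord_recr/= eqxx -SZ -[y in LHS](subrK (F n y *: e)).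
  rewrite -[_ + _]scale1r -[X in S (1 *: (X + _))]/(P y) scalerDr !scale1r.
  rewrite -[P y]scale1r Sl scale1r; congr (_ + _); rewrite [LHS]wS.
  by apply: eq_bigr => j _; rewrite ltn_eqF.
have [|w wS] := IH S Sl.
  move=> y yF; apply: S0 => j; rewrite ltnS leq_eqVlt => /predU1P[->|/yF//].
  have [//|yn] := eqVneq (F n y) 0; exfalso; apply: H.
  exists ((F n y)^-1 *: y); split.
    by rewrite (norm_le_linearZ (Fl n)) mulVf.
  by move=> i /yF yi; rewrite (norm_le_linearZ (Fl i)) yi mulr0.
exists (fun j => if j == n then 0 else w j) => y.
rewrite big_ord_recr/= eqxx S00 scaler0 addr0 wS.
by apply: eq_bigr => j _; rewrite ltn_eqF.
Qed.

(* The unit ball of [N] is the closed convex hull of the unit ball of [q] and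
   the ball of radius [1 / C] of [X]. *)
Lemma hull_norm (R : realType) (X : normedModType R) (A : closedSubspace X)
    (q : subspace_type A -> R) (C : R) : 2 <= C ->
  (forall x y : subspace_type A, q (x + y) <= q x + q y) ->
  (forall (a : R) (x : subspace_type A), q (a *: x) = `|a| * q x) ->
  (forall x : subspace_type A, `|x| <= q x <= 2 * `|x|) ->
  exists N : equiv_norm X, [/\ forall y, N (val y) = q y,
    forall x, `|x| <= N x <= C * `|x| &
    forall x (r : R), N x < r -> exists y, q y + C * `|x - val y| < r].
Proof.
move=> C2 qD qZ qn.
have C0 : 0 <= C by rewrite (le_trans _ C2).
(* The gauge of the hull is the infimal convolution of [q] on [A] with [C] times the norm. *)
pose E x : set R := [set q y + C * `|x - val y| | y in setT].
have Elb x : lbound (E x) `|x|.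
  move=> _ [y _ <-]; have /andP[yq _] := qn y; rewrite subspace_normE in yq.
  have : `|x| <= `|val y| + `|x - val y|.
    by rewrite -{1}[x](subrK (val y)) addrC ler_normD.
  have : 1 * `|x - val y| <= C * `|x - val y| by rewrite ler_wpM2r//; lra.
  lra.
have Einf x : has_inf (E x).
  split; first by exists (q 0 + C * `|x - val (0 : subspace_type A)|); exists 0.
  by exists `|x|; exact: Elb.
pose N x := inf (E x).
have Nle x y : N x <= q y + C * `|x - val y|.
  by apply: (ge_inf (Einf x).2); exists y.
have Nlt x (r : R) : N x < r -> exists y, q y + C * `|x - val y| < r.
  by move=> /(inf_lt (Einf x).1)[_ [y _ <-] yr]; exists y.
have Nge x (r : R) : (forall y, r <= q y + C * `|x - val y|) -> r <= N x.
  by move=> H; apply: (lb_le_inf (Einf x).1) => _ [y _ <-].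
have q0 : q 0 = 0 by rewrite -(scale0r 0) qZ normr0 mul0r.
have NC x : N x <= C * `|x|.
  by have := Nle x 0; rewrite q0 add0r -[val 0]/(0 : X) subr0.
have Npos x : `|x| <= N x by apply: (lb_le_inf (Einf x).1); exact: Elb.
have NZle a x : N (a *: x) <= `|a| * N x.
  have [->|a0] := eqVneq a 0.
    by rewrite scale0r normr0 mul0r (le_trans (NC 0))// normr0 mulr0.
  rewrite -ler_pdivrMl ?normr_gt0//; apply: Nge => y.
  rewrite ler_pdivrMl ?normr_gt0// mulrDr -qZ mulrCA -normrZ scalerBr.
  exact: (Nle _ (a *: y)).
have NZ a x : N (a *: x) = `|a| * N x.
  apply/eqP; rewrite eq_le NZle/=.
  have [->|a0] := eqVneq a 0.
    by rewrite normr0 mul0r (le_trans _ (Npos _)).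
  by have := NZle a^-1 (a *: x); rewrite scalerA mulVf// scale1r normfV
    ler_pdivlMl ?normr_gt0.
have ND x y : N (x + y) <= N x + N y.
  apply/ler_addgt0Pr => e e0.
  have [|u ux] := Nlt x (N x + e / 2); first by rewrite ltrDl divr_gt0.
  have [|v vy] := Nlt y (N y + e / 2); first by rewrite ltrDl divr_gt0.
  have := Nle (x + y) (u + v); have := qD u v.
  have -> : x + y - val (u + v) = (x - val u) + (y - val v).
    by rewrite -[val (u + v)]/(val u + val v) opprD addrACA.
  have : C * `|x - val u + (y - val v)| <= C * (`|x - val u| + `|y - val v|).
    by rewrite ler_wpM2l// ler_normD.
  lra.
have Nequiv : exists m M : R, [/\ 0 < m, 0 < M &
    forall x, m * `|x| <= N x <= M * `|x|].
  by exists 1, C; split=> [//||x]; [lra|rewrite mul1r Npos NC].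
exists (EquivNorm ND NZ Nequiv); split=> //= y; last by rewrite Npos NC.
apply/eqP; rewrite eq_le.
apply/andP; split.
  by have := Nle (val y) y; rewrite subrr normr0 mulr0 addr0.
(* As [q <= 2 * |.|] on [A] and [2 <= C], leaving [y] for another point [z] of [A] never costs less
   than [q y]. *)
apply: Nge => z; have := qD z (y - z); rewrite addrC subrK.
have := qn (y - z); rewrite subspace_normE -[val (y - z)]/(val y - val z).
move=> /andP[_ h1].
have : 2 * `|val y - val z| <= C * `|val y - val z| by rewrite ler_wpM2r.
lra.
Qed.

(** Strict convexity: [v] is not the midpoint of two other points of the ball of radius [|v|]. *)
Definition rotund (R : realType) (Z : normedModType R) : Prop :=
  forall v w : Z, `|v + w| <= `|v| -> `|v - w| <= `|v| -> w = 0.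

Section Attaining.
Context {R : realType} {X : normedModType R} (A : closedSubspace X).
Context (q : subspace_type A -> R) (F : nat -> subspace_type A -> R) (C : R).
Context (N : equiv_norm X).
Hypothesis Fl : forall n, norm_le_linear (F n).
Hypothesis qF : forall x : subspace_type A, x != 0 ->
  exists (n : nat) (d : R), 0 < d /\ forall y : subspace_type A,
    `|y| <= d -> (forall j, (j < n)%N -> F j y = 0) -> q (x + y) <= q x.
Hypothesis NA : forall y, N (val y) = q y.
Hypothesis Nlt : forall x (r : R), N x < r ->
  exists y : subspace_type A, q y + C * `|x - val y| < r.

(* [S] being much smaller on the ball of radius [1 / C] than on the ball of
   [q], it can only attain its norm inside [A]. *)
Lemma norm_attaining_common_kernel (Z : normedModType R)
    (S : boundedOp (renormed N) Z) (M : R) :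
  rotund Z -> (forall x : X, `|S x| <= M * `|x|) -> M < C * `|S| ->
  norm_attaining (renormed N) Z S ->
  exists (n : nat) (w : nat -> subspace_type A), forall y : subspace_type A,
    S (val y) = \sum_(j < n) F j y *: S (val (w j)).
Proof.
move=> Zr SM MC [x0]; rewrite -[`|x0|]/(N x0) => Nx0 Sx0.
have SN (x : X) : `|S x| <= `|S| * N x by exact: (opnormP S x).
have S0 : 0 <= `|S| by exact: opnorm_ge0.
have [g gE] : exists g, g = C * `|S| - M by exists (C * `|S| - M).
have g0 : 0 < g by rewrite gE subr_gt0.
(* If [q y + C * |x0 - y| < 1 + k], then [g * |x0 - y| <= |S| * k]; the chosen [k] makes the right
   side less than [g * e]. *)
have : closure (subspace_set A) x0.
  move=> B /nbhs_ballP[e/= e0 eB].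
  have k0 : 0 < e * g / (`|S| + 1) by rewrite divr_gt0 ?mulr_gt0// ltr_wpDl.
  have [|y yN] := Nlt (x := x0) (r := 1 + e * g / (`|S| + 1)).
    by rewrite Nx0 ltrDl.
  exists (val y); split; first exact: subspace_set_val.
  apply: eB; rewrite -ball_normE/=.
  have h1 : `|S x0| <= `|S (val y)| + `|S (x0 - val y)|.
    rewrite -{1}[x0](subrK (val y : renormed N)) addrC.
    by rewrite (le_trans _ (ler_normD _ _))// -(linearD S).
  have h2 : `|S (val y)| <= `|S| * q y by rewrite -NA; exact: SN.
  have h3 := SM (x0 - val y).
  have h4 : `|S| * (e * g / (`|S| + 1)) < e * g.
    rewrite mulrA ltr_pdivrMr ?ltr_wpDl// mulrC ltr_pM2l ?mulr_gt0//.
    by rewrite ltrDl.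
  have h5 : `|S| * (q y + C * `|(x0 : X) - val y|) <=
      `|S| * (1 + e * g / (`|S| + 1)) by rewrite ler_wpM2l// ltW.
  have : g * `|(x0 : X) - val y| < g * e.
    move: (e * g / _) h4 h5 => k h4 h5; rewrite -Sx0 in h1.
    by rewrite gE in h4 *; lra.
  by rewrite ltr_pM2l.
rewrite -(closure_id _).1; last exact: subspace_closed.
move=> Ax0; pose y0 := to_subspace Ax0.
have qy0 : q y0 = 1 by rewrite -NA.
have y00 : y0 != 0.
  have N0 : N 0 = 0 by rewrite -(scale0r (0 : X)) equiv_normZ normr0 mul0r.
  apply/eqP => y0E; move: qy0; rewrite -NA y0E -[val 0]/(0 : X) N0; lra.
have [n [d [d0 flat]]] := qF y00; exists n.
apply: (linear_common_kernel (S := fun y : subspace_type A => S (val y)) Fl).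
  by move=> a x y; exact: (linearP S).
move=> y yF.
(* Small moves in the common kernel keep [y0] in the ball. Applied to [t *: y] and its opposite,
   this makes [S y0] a midpoint, and rotundity gives [S y = 0]. *)
have sub v : `|v| <= d -> (forall j, (j < n)%N -> F j v = 0) ->
    `|S (val y0) + S (val v)| <= `|S (val y0)|.
  move=> vd vF; have := flat v vd vF; rewrite -NA qy0 => Nv.
  rewrite -[X in `|X| <= _](linearD S) -Sx0.
  apply: (le_trans (SN _)); rewrite ler_piMr//.
pose t := d / (`|y| + 1).
have t0 : 0 < t by rewrite divr_gt0// ltr_wpDl.
have ty : `|t *: y| <= d.
  rewrite normrZ gtr0_norm// /t mulrAC ler_pdivrMr ?ltr_wpDl//.
  by rewrite ler_pM2l// lerDl.
have tS : S (val (t *: y)) = t *: S (val y).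
  exact: (linearZ_LR S t (val y : renormed N)).
have tF j : (j < n)%N -> F j (t *: y) = 0.
  by move=> jn; rewrite (norm_le_linearZ (Fl j)) yF// mulr0.
have : S (val (t *: y)) = 0.
  apply: (Zr (S (val y0))); first exact: sub.
  rewrite -[- _](linearN S); apply: (sub (- (t *: y))); first by rewrite normrN.
  by move=> j jn; rewrite (norm_le_linearN (Fl j)) tF// oppr0.
rewrite tS => /eqP; rewrite scaler_eq0 gt_eqF//= => /eqP //.
Qed.

End Attaining.

(** * Separable subspaces and the coordinate operator *)

Lemma separable_subspace (R : realType) (X : normedModType R) (u : nat -> X) :
  exists (A : closedSubspace X) (e : nat -> subspace_type A),
    dense_seq e /\ forall n, subspace_set A (u n).
Proof.
(* Finite lists of pairs code the rational combinations, a countable set dense in the closed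
   span. *)
pose comb (l : seq (rat * nat)) : X := \sum_(p <- l) (ratr p.1 : R) *: u p.2.
have D0 : range comb 0 by exists [::] => //; rewrite /comb big_nil.
have clP : forall (a : R) x y, closure (range comb) x ->
    closure (range comb) y -> closure (range comb) (a *: x + y).
  apply: (closure_subspaceP D0) => [x y [l _ <-] [m _ <-]|a x [l _ <-]].
    by exists (l ++ m) => //; rewrite /comb big_cat.
  move=> B /nbhs_ballP[e/= e0 eB].
  pose d := e / (`|comb l| + 1).
  have d0 : 0 < d by rewrite divr_gt0// ltr_wpDl.
  have [|r] := @rat_in_itvoo R (a - d) (a + d).
    by rewrite ltrD2l; lra.
  rewrite in_itv/= => /andP[r1 r2].
  exists (comb [seq (r * p.1, p.2) | p <- l]); split; first by eexists.
  have -> : comb [seq (r * p.1, p.2) | p <- l] = ratr r *: comb l.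
    rewrite /comb big_map scaler_sumr; apply: eq_bigr => p _ /=.
    by rewrite rmorphM scalerA.
  apply: eB; rewrite -ball_normE/= -scalerBl normrZ.
  have : `|a - ratr r| < d by rewrite ltr_distlC r1 r2.
  rewrite /d ltr_pdivlMr ?ltr_wpDl//; apply: le_lt_trans.
  by rewrite ler_wpM2l// lerDl.
pose A := ClosedSubspace (@closed_closure _ (range comb))
  (subset_closure D0) clP.
have Acomb l : subspace_set A (comb l) by apply: subset_closure; exists l.
exists A, (fun n => if unpickle n is Some l then to_subspace (Acomb l) else 0).
split=> [x d d0|n].
  have [_ [l _ <-] xl] := closure_approx (subspace_set_val x) d0.
  by exists (pickle l); rewrite pickleK.
by have := Acomb [:: (1, n)]; rewrite /comb big_seq1/= rmorph1 scale1r.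
Qed.

(** [Z] is the closure of the range of [T] in the bounded sequences, renormed. Taking the closure
    gives the last clause, by which vectors of [Z] are traded for vectors of [X]. *)
Lemma coordinate_operator (R : realType) (X : normedModType R)
    (c : nat -> dual_space X) : totally_bounded_seq c ->
  exists (Z : completeNormedModType R) (T : X -> Z) (h : nat -> Z -> R) (M : R),
    [/\ linear T /\ 0 <= M, forall x, `|T x| <= M * `|x|, rotund Z,
     forall n, norm_le_linear (h n) &
     [/\ forall z (e : R), (forall n, `|h n z| <= e) -> `|z| <= 2 * e,
       forall n x, h n (T x) = c n x &
       forall z (e : R), 0 < e -> exists x, forall n, `|h n z - c n x| <= e]].
Proof.
move=> tb; have [M cM] := totally_bounded_seq_bounded tb.
have M0 : 0 <= M by rewrite (le_trans _ (cM 0%N)).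
have cxM x n : `|c n x : R| <= M * `|x|.
  by rewrite (le_trans (opnormP (c n) x))// ler_wpM2r//; exact: cM.
have cB x : (fun n => c n x : R^o) \in bounded_seq_pred R.
  by apply/mem_set; exists (M * `|x|) => n; exact: cxM.
pose T0 x := BoundedSeq (cB x).
have T0l : linear T0.
  by move=> a x y; apply/val_inj/funext => n; exact: (linearP (c n)).
have T00 : range T0 0.
  by exists 0 => //; apply/val_inj/funext => n; exact: (linear0 (c n)).
have clP := @closure_subspaceP R (bounded_seq R) (range T0) T00.
have {}clP : forall (a : R) x y, closure (range T0) x -> closure (range T0) y ->
    closure (range T0) (a *: x + y).
  apply: clP => [x y [u _ <-] [v _ <-]|a x [u _ <-]].
    by exists (u + v) => //; rewrite -[u]scale1r T0l !scale1r.
  apply: subset_closure; exists (a *: u) => //.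
  by apply/val_inj/funext => n; exact: (linearZ_LR (c n) a u).
pose A := ClosedSubspace (@closed_closure _ (range T0))
  (subset_closure T00) clP.
have AT x : subspace_set A (T0 x) by apply: subset_closure; exists x.
pose h n (z : subspace_type A) : R := val z n.
have hl n : norm_le_linear (h n).
  split=> [a x y|z]; first by rewrite /h subspace_linearE bounded_seq_linearE.
  rewrite subspace_normE bounded_seq_normE.
  by rewrite (le_trans (ler_norm _))// sup_norm_ge.
have [N [Nn Nr]] := strictly_convex_renorming hl.
pose T x : renormed N := to_subspace (AT x).
have NT x : `|T x| <= (2 * M) * `|x|.
  apply: le_trans (proj2 (andP (Nn (to_subspace (AT x))))) _.
  rewrite -mulrA ler_wpM2l//; apply: sup_norm_le => n; exact: cxM.
have Tl : linear T by move=> a x y; apply/val_inj; exact: T0l.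
have Zr : rotund (renormed N).
  move=> v w vw vw'; apply/val_inj/val_inj/funext => n.
  exact: (Nr v w vw vw' n).
have hl' n : @norm_le_linear R (renormed N) (h n).
  split=> [a x y|x]; first exact: (hl n).1.
  exact: le_trans ((hl n).2 x) (proj1 (andP (Nn x))).
have hZ (z : renormed N) (e : R) : (forall n, `|h n z| <= e) -> `|z| <= 2 * e.
  move=> ze; apply: le_trans (proj2 (andP (Nn z))) _.
  rewrite ler_wpM2l// subspace_normE bounded_seq_normE.
  exact: sup_norm_le.
have hTx (z : renormed N) (e : R) : 0 < e ->
    exists x, forall n, `|h n z - c n x| <= e.
  move=> e0; pose z0 : subspace_type A := z.
  have [_ [x _ <-] zx] := closure_approx (subspace_set_val z0) e0.
  exists x => n; apply: le_trans (ltW zx).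
  exact: (sup_norm_ge (val z0 - T0 x) n).
exists (renormed N), T, h, (2 * M).
split; [|exact: NT|exact: Zr|exact: hl'|split; [exact: hZ|by []|exact: hTx]].
by split; [exact: Tl|rewrite mulr_ge0].
Qed.

(** * The renorming that fails property A^k *)

Theorem corollary2p9 (R : realType) (X : completeNormedModType R) :
  polyhedral X ->
  ~ approximation_property (dual_space X) ->
  exists N : equiv_norm X, ~ property_Ak (renormed N).
Proof.
move=> pX nAP.
have [c [eps [eps0 tb cT]]] := not_approximation_property_seq nAP.
(* Otherwise, for some rank and bound, approximations on all finite sets would yield a finite rank
   operator on the dual, against [cT]. *)
have /choice[s sP] : forall kB : nat * nat, exists s : seq X, forall phi xi,
    ~ @approximates R X kB.1 kB.2%:R c eps [set` s] phi xi.
  move=> kB; apply: contrapT => H.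
  have [|T Tf TP] :=
    @approximates_finite_rank R X kB.1 kB.2%:R c eps (ltW eps0).
    move=> s; apply: contrapT => H'; apply: H; exists s => phi xi a.
    by apply: H'; exists phi, xi.
  by have [n] := cT T Tf; rewrite ltNge TP.
(* [A] contains all of these countably many finite sets. *)
have [A [e [eD eA]]] := separable_subspace
  (fun n => if unpickle n is Some i then (s i.1)`_i.2 else 0).
have sA kB x : x \in s kB -> subspace_set A x.
  move=> xs; have := eA (pickle (kB, index x (s kB))).
  by rewrite pickleK/= nth_index.
have aff : ray_affine (subspace_type A).
  move=> x y; exact: (polyhedral_ray_affine pX (val x) (val y)).
have [F [q [Fl qD qZ qn qF]]] := locally_finite_norm eD aff.
have [Z [T [h [M [[Tl M0] TM Zr hl [hZ hT hTx]]]]]] := coordinate_operator tb.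
pose TL : {linear X -> Z} := HB.pack T (GRing.isLinear.Build R X Z _ T Tl).
(* If [T] vanished on [A], the empty sum would approximate [c] on [s (0, 0)]. *)
have [b Tb] : exists b : subspace_type A, T (val b) != 0.
  apply: contrapT => H.
  apply: (sP (0%N, 0%N) (fun _ _ => 0) (fun=> 0)); split=> [i||i|x n xs].
  - by case: i.
  - by move=> i; case: i.
  - by case: i.
  rewrite big_ord0 sub0r normrN -hT.
  rewrite (_ : T x = 0).
    by rewrite (norm_le_linear0 (hl n)) normr0 mulr_ge0 ?(ltW eps0).
  apply/eqP/negPn/negP => Tx; apply: H.
  by exists (to_subspace (sA _ _ xs)).
have b0 : 0 < `|b|.
  rewrite normr_gt0; apply: contra Tb => /eqP ->.
  by rewrite -[T _]/(TL 0) linear0.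
have qb : 0 < q b by rewrite (lt_le_trans b0)//; have /andP[] := qn b.
have [tau tauE] : exists tau, tau = `|T (val b)| / q b by eexists.
have tau0 : 0 < tau by rewrite tauE divr_gt0// normr_gt0.
(* This gives [C * tau = 2 * tau + 2 * M], so that for [eta <= tau / 4] one has
   [M + eta * C < C * (tau - eta)]. *)
have [C CE] : exists C, C = 2 + 2 * M / tau by exists (2 + 2 * M / tau).
have C2 : 2 <= C.
  by rewrite CE lerDl; apply: divr_ge0; [exact: mulr_ge0|exact: ltW].
have [N [NA Nn Nlt]] := hull_norm C2 qD qZ qn.
exists N => Ak.
have TN (x : renormed N) : `|T x| <= M * `|x|.
  by apply: (le_trans (TM x)); rewrite ler_wpM2l//; have /andP[] := Nn x.
pose TT : boundedOp (renormed N) Z :=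
  BoundedOp (@bounded_linear_of_le R (renormed N) Z T M Tl TN).
have hTT k (y : renormed N) : h k (TT y) = c k (y : X) by exact: hT.
have TTc : compact_operators (renormed N) Z TT.
  apply: (compact_operators_coordinates hl) => // d d0.
  have [m cm] := tb d d0; exists m => n; have [i im ni] := cm n.
  exists i => // x x1; rewrite !hTT.
  apply: (le_trans (boundedOp_distP (c n) (c i) x)).
  have x1' : `|x : X| <= 1 by apply: le_trans x1; have /andP[] := Nn x.
  apply: (@le_trans _ _ (d * 1)); last by rewrite mulr1.
  by apply: ler_pM => //; exact: ltW.
(* The first bound lets [S] attain its norm only in [A]; the second gives an error of at most
   [eps / 2 * |x|] on [A], where [N x <= 2 * |x|]. *)
have [eta [eta0 eta1 eta2]] : exists eta : R, [/\ 0 < eta, eta <= tau / 4 &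
    eta <= eps / 4].
  exists (Num.min (tau / 4) (eps / 4)).
  split; [by rewrite lt_min !divr_gt0|by rewrite ge_min lexx|].
  by rewrite ge_min lexx orbT.
have [S [[_ SNA] TS]] := Ak Z TT TTc _ (nbhsx_ballx TT eta eta0).
move: TS; rewrite -ball_normE/= => TS.
have TSN (x : renormed N) : `|T x - S x| <= eta * N x.
  apply: (le_trans (opnormP (TT - S) x)); apply: ler_wpM2r => //.
  exact: ltW.
have tauT : tau <= `|TT|.
  rewrite tauE ler_pdivrMr// -NA; exact: (opnormP TT (val b)).
have Stau : tau - eta <= `|S|.
  have := ler_normD (TT - S) S; rewrite subrK; lra.
have [n [w wS]] : exists (n : nat) (w : nat -> subspace_type A),
    forall y : subspace_type A, S (val y) = \sum_(j < n) F j y *: S (val (w j)).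
  have SM (x : X) : `|S x| <= (M + eta * C) * `|x|.
    have /andP[_ NC] := Nn x.
    have h1 : `|S x| <= `|T x| + `|T x - S x|.
      by rewrite -{1}[S x](subKr (T x)) ler_normB.
    have h2 : eta * N x <= eta * (C * `|x|) by rewrite ler_wpM2l// ltW.
    have := TSN x; have := TM x; lra.
  have CS : M + eta * C < C * `|S|.
    have : C * (tau - eta) <= C * `|S| by rewrite ler_wpM2l//; lra.
    have : C * eta <= C * (tau / 4) by rewrite ler_wpM2l//; lra.
    have : C * tau = 2 * tau + 2 * M by rewrite CE mulrDl divfK ?gt_eqF.
    lra.
  exact: (norm_attaining_common_kernel Fl qF NA Nlt Zr SM CS SNA).
have k0 : 0 < eps / 2 / n.+1%:R by rewrite !divr_gt0.
(* The [n] errors add up to at most [eps / 2]; dividing by [n.+1] covers [n = 0]. *)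
have /choice[xi xiP] : forall j : 'I_n, exists x, forall m,
    `|h m (S (val (w j))) - c m x| <= eps / 2 / n.+1%:R.
  by move=> j; exact: hTx.
have [B BE] : exists B : nat, forall j, `|xi j| <= B%:R.
  exists (Num.truncn (\sum_j `|xi j|)).+1 => j.
  rewrite (le_trans _ (ltW (truncnS_gt _)))// (bigD1 j)//= lerDl.
  exact: sumr_ge0.
(* The extension by [0] outside [A] is harmless: linearity is tested only at points of [s (n, B)],
   which lie in [A]. *)
pose phi (j : 'I_n) (x : X) : R :=
  if pselect (subspace_set A x) is left xA then F j (to_subspace xA) else 0.
have phiE j (y : subspace_type A) : phi j (val y) = F j y.
  rewrite /phi; case: pselect => [yA|/(_ (subspace_set_val y))//].
  by congr (F j _); exact/val_inj.
(* The finite rank of [S] on [A] contradicts the choice of [s (n, B)]. *)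
apply: (sP (n, B) phi xi); split=> //.
- move=> i a x y xs ys; rewrite -[x]/(val (to_subspace (sA _ _ xs))).
  rewrite -[y]/(val (to_subspace (sA _ _ ys))) !phiE -(Fl i).1 -phiE.
  by [].
- move=> i x; rewrite /phi; case: pselect => [xA|_]; last by rewrite normr0.
  exact: norm_le_linear_abs (Fl i) _.
move=> x m xs; pose y := to_subspace (sA _ _ xs).
have hsum (v : 'I_n -> Z) : h m (\sum_j v j) = \sum_j h m (v j).
  apply: (big_morph (h m)); last exact: norm_le_linear0 (hl m).
  exact: norm_le_linearD (hl m).
have h1 : `|h m (S x) - c m x| <= eps / 2 * `|x|.
  rewrite distrC -hT -(norm_le_linearB (hl m)).
  apply: (le_trans (norm_le_linear_abs (hl m) _)); apply: (le_trans (TSN x)).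
  have Nx : N x <= 2 * `|x| by rewrite -[x]/(val y) NA; have /andP[] := qn y.
  have : eta * N x <= eps / 4 * (2 * `|x|).
    by apply: ler_pM => //; [exact: ltW|apply: le_trans (proj1 (andP (Nn x)))].
  lra.
have h2 : `|\sum_i (c m (xi i) : R) * phi i x - h m (S x)| <= eps / 2 * `|x|.
  rewrite -[x in S x]/(val y) wS hsum -sumrB.
  apply: (le_trans (ler_norm_sum _ _ _)).
  apply: (@le_trans _ _ (\sum_(i < n) eps / 2 / n.+1%:R * `|x|)).
    apply: ler_sum => i _; rewrite -[x in phi i x]/(val y) phiE.
    rewrite (norm_le_linearZ (hl m)) mulrC -mulrBr normrM mulrC distrC.
    by apply: ler_pM => //; exact: norm_le_linear_abs (Fl i) y.
  have nE : eps / 2 / n.+1%:R * `|x| * n%:R =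
      (eps / 2 * `|x|) * (n%:R / n.+1%:R).
    by move: (n.+1%:R^-1) => r; ring.
  rewrite sumr_const card_ord -[leLHS]mulr_natr nE.
  apply: ler_piMr; first by rewrite mulr_ge0 ?divr_ge0 ?(ltW eps0).
  by rewrite ler_pdivrMr// mul1r ler_nat.
rewrite -[_ - _](subrKA (h m (S x))) (le_trans (ler_normD _ _))//.
by rewrite (le_trans (lerD h2 h1))// -mulrDl -splitr.
Qed.
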